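(* The set of sentences of the well-formed fragment of hybrid $\mathrm{CTL}^*_{lp}$ has the same expressiveness as $\mathrm{CTL}^*$: every well-formed sentence of hybrid $\mathrm{CTL}^*_{lp}$ is equivalent to a $\mathrm{CTL}^*$ formula and vice versa, where two formulas are equivalent if they have the same finite Kripke structures as models.
   Context: A Kripke structure over a finite set $\mathcal{AP}$ is $K=(\mathcal{AP},S,\delta,\mu,s_0)$ with states $S$, left-total $\delta\subseteq S\times S$, labelling $\mu:S\to2^{\mathcal{AP}}$, initial state $s_0$; finite if $S$ is finite. Infinite paths are infinite state sequences following $\delta$; initial means starting at $s_0$. $\mathrm{CTL}^*$: $\varphi::=\top\mid p\mid\neg\varphi\mid\varphi\wedge\varphi\mid\mathsf X\varphi\mid\varphi\mathsf U\varphi\mid\exists\varphi$ with the standard semantics over positions of infinite paths; $K$ is a model iff $\pi,0\models\varphi$ for every initial infinite path $\pi$. Hybrid $\mathrm{CTL}^*_{lp}$: with position variables $x,y,\dots$, $\varphi::=\top\mid p\mid x\mid\neg\varphi\mid\varphi\vee\varphi\mid{\downarrow}x.\varphi\mid\mathsf X\varphi\mid\varphi\mathsf U\varphi\mid\mathsf X^-\varphi\mid\varphi\mathsf U^-\varphi\mid\exists\varphi$, interpreted on an initial infinite path $\pi$, valuation $g$ of variables to positions, and position $i$: $x$ holds iff $g(x)=i$; ${\downarrow}x.\varphi$ iff $\pi,g[x\leftarrow i],i\models\varphi$; $\mathsf X,\mathsf U$ as usual; $\mathsf X^-\varphi$ iff $i>0$ and $\pi,g,i-1\models\varphi$; $\varphi_1\mathsf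 U^-\varphi_2$ iff some $j\le i$ has $\pi,g,j\models\varphi_2$ and $\pi,g,k\models\varphi_1$ for all $j<k\le i$; $\exists\varphi$ iff some initial infinite path $\pi'$ with $\pi'[0,i]=\pi[0,i]$ has $\pi',g,i\models\varphi$. $\mathsf F^-\varphi:=\top\mathsf U^-\varphi$. $K$ is a model of $\varphi$ iff $\pi,g_0,0\models\varphi$ for every initial infinite path $\pi$, $g_0$ assigning $0$ to all variables. A formula is well-formed if every subformula $\exists\psi$ has at most one free variable (not bound by ${\downarrow}$), and every subformula $\exists\psi(x)$ with free variable $x$ occurs in the context $(\mathsf F^-x)\wedge\exists\psi(x)$. A sentence has no free variables. *)

(* Defs.v *)
From mathcomp Require Import all_boot.
Set Implicit Arguments. Unset Strict Implicit. Unset Printing Implicit Defensive.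

Record Kripke (AP : finType) : Type := MkKripke {
  St : finType;
  delta : rel St;
  delta_total : forall s : St, exists t : St, delta s t;
  mu : St -> {set AP};
  s0 : St
}.

Definition is_path (AP : finType) (K : Kripke AP) (p : nat -> St K) : Prop :=
  forall n, delta (p n) (p n.+1).

Definition is_init_path (AP : finType) (K : Kripke AP) (p : nat -> St K) : Prop :=
  is_path p /\ p 0 = s0 K.

Inductive cform (AP : finType) : Type :=
| CTop
| CAtom of AP
| CNot of cform AP
| CAnd of cform AP & cform AP
| CNext of cform AP
| CUntil of cform AP & cform AP
| CEx of cform AP.

Fixpoint csat (AP : finType) (K : Kripke AP) (p : nat -> St K) (i : nat)
  (f : cform AP) : Prop :=
  match f with
  | CTop => True
  | CAtom a => a \in mu (p i)
  | CNot g => ~ csat p i g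
  | CAnd g h => csat p i g /\ csat p i h
  | CNext g => csat p i.+1 g
  | CUntil g h => exists j, i <= j /\ csat p j h /\
                    (forall k, i <= k -> k < j -> csat p k g)
  | CEx g => exists p' : nat -> St K, is_path p' /\ p' 0 = p i /\ csat p' 0 g
  end.

Definition cmodel (AP : finType) (K : Kripke AP) (f : cform AP) : Prop :=
  forall p : nat -> St K, is_init_path p -> csat p 0 f.

Inductive hform (AP : finType) : Type :=
| HTop
| HAtom of AP
| HVar of nat
| HNot of hform AP
| HOr of hform AP & hform AP
| HBind of nat & hform AP
| HNext of hform AP
| HUntil of hform AP & hform AP
| HPrev of hform AP
| HSince of hform AP & hform AP
| HEx of hform AP.

Fixpoint hsat (AP : finType) (K : Kripke AP) (p : nat -> St K) (g : nat -> nat)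
  (i : nat) (f : hform AP) : Prop :=
  match f with
  | HTop => True
  | HAtom a => a \in mu (p i)
  | HVar x => g x = i
  | HNot h => ~ hsat p g i h
  | HOr h1 h2 => hsat p g i h1 \/ hsat p g i h2
  | HBind x h => hsat p (fun y => if y == x then i else g y) i h
  | HNext h => hsat p g i.+1 h
  | HUntil h1 h2 => exists j, i <= j /\ hsat p g j h2 /\
                      (forall k, i <= k -> k < j -> hsat p g k h1)
  | HPrev h => 0 < i /\ hsat p g i.-1 h
  | HSince h1 h2 => exists j, j <= i /\ hsat p g j h2 /\
                      (forall k, j < k -> k <= i -> hsat p g k h1)
  | HEx h => exists p' : nat -> St K, is_init_path p' /\
               (forall k, k <= i -> p' k = p k) /\ hsat p' g i h
  end.

Definition hmodel (AP : finType) (K : Kripke AP) (f : hform AP) : Prop :=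
  forall p : nat -> St K, is_init_path p -> hsat p (fun _ => 0) 0 f.

Fixpoint fv (AP : finType) (f : hform AP) : seq nat :=
  match f with
  | HTop | HAtom _ => [::]
  | HVar x => [:: x]
  | HNot h | HNext h | HPrev h | HEx h => fv h
  | HOr h1 h2 | HUntil h1 h2 | HSince h1 h2 => fv h1 ++ fv h2
  | HBind x h => [seq y <- fv h | y != x]
  end.

Definition sentence (AP : finType) (f : hform AP) : bool := nilp (fv f).

Definition HAnd (AP : finType) (f g : hform AP) : hform AP :=
  HNot (HOr (HNot f) (HNot g)).
Definition HOnce (AP : finType) (f : hform AP) : hform AP := HSince (HTop AP) f.

(* Well-formedness: every subformula HEx psi has at most one free variable,
   and if it has a free variable x, it occurs in the context
   (F^- x) /\ HEx psi  (i.e. HAnd (HOnce (HVar x)) (HEx psi)). *)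
Fixpoint wf (AP : finType) (f : hform AP) : bool :=
  match f with
  | HNot (HOr (HNot (HSince HTop (HVar x))) (HNot (HEx psi)) as g) =>
      (all (fun y => y == x) (fv psi) && wf psi) || wf g
  | HTop | HAtom _ | HVar _ => true
  | HNot h | HNext h | HPrev h | HBind _ h => wf h
  | HOr h1 h2 | HUntil h1 h2 | HSince h1 h2 => wf h1 && wf h2
  | HEx h => nilp (fv h) && wf h
  end.

Definition equiv_hc (AP : finType) (f : hform AP) (c : cform AP) : Prop :=
  forall K : Kripke AP, hmodel K f <-> cmodel K c.

(* Main.v *)
(* A position of a path splits it into a finite history and an infinite future,
   and by Ehrenfeucht-Fraisse composition the truth of a hybrid formula only
   depends on the letters at the marked positions and on the rank-k first-order
   types of the segments between them. For [HEx psi] the guard [F^- x] puts all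
   marks in the history, so the formula only sees types of history segments and
   the finite set of types of futures available from the current state. Once
   that set is CTL*-definable, it can be added to the label of the state, and the
   formula becomes invariant for types over the enlarged alphabet.

   The definability comes from Kamp's theorem in the form "every rank-k type of
   omega-words is LTL-definable". Finite words modulo rank-k equivalence form a
   finite aperiodic monoid, and "some prefix has value m and the rest satisfies
   D" is shown to be LTL-definable by the local divisor technique of Diekert and
   Gastin: cutting a word at the occurrences of a letter c of value <> 1 yields a
   word over a new alphabet, evaluated in the smaller monoid cM inter Mc. *)
Require Import Defs.
From mathcomp Require Import all_boot boolp zify.

Set Implicit Arguments.
Unset Strict Implicit.
Unset Printing Implicit Defensive.

Definition shift (A : Type) n (w : nat -> A) : nat -> A := fun j => w (n + j).

Lemma shift0 (A : Type) (w : nat -> A) : shift 0 w = w.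
Proof. by apply: funext => j. Qed.

Lemma shiftD (A : Type) m n (w : nat -> A) : shift m (shift n w) = shift (n + m) w.
Proof. by apply: funext => j; rewrite /shift addnA. Qed.

Lemma mkseqD (A : Type) (w : nat -> A) m n :
  mkseq w (m + n) = mkseq w m ++ mkseq (shift m w) n.
Proof.
by rewrite /mkseq iotaD map_cat add0n -{2}[m]addn0 iotaDl -map_comp.
Qed.

Lemma mkseqS1 (A : Type) (w : nat -> A) n :
  mkseq w n.+1 = w 0 :: mkseq (shift 1 w) n.
Proof. by rewrite -add1n mkseqD. Qed.

(** * LTL-definable sets of infinite words *)

(** LTL is represented by the properties it defines instead of formulas, so that equivalent
    properties are equal by extensionality and can be exchanged. *)
Inductive ltl (A : finType) : ((nat -> A) -> Prop) -> Prop :=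
| ltl_true : ltl (fun=> True)
| ltl_letter a : ltl (fun w => w 0 = a)
| ltl_not D : ltl D -> ltl (fun w => ~ D w)
| ltl_and D1 D2 : ltl D1 -> ltl D2 -> ltl (fun w => D1 w /\ D2 w)
| ltl_next D : ltl D -> ltl (fun w => D (shift 1 w))
| ltl_until D1 D2 : ltl D1 -> ltl D2 ->
    ltl (fun w => exists j, D2 (shift j w) /\ forall i, i < j -> D1 (shift i w)).

Section LTLClosure.
Variable A : finType.
Implicit Types (D : (nat -> A) -> Prop) (w : nat -> A).

Lemma ltl_ext D D' : (forall w, D w <-> D' w) -> ltl D -> ltl D'.
Proof. by move=> /predeqP ->. Qed.

Lemma ltl_or D1 D2 : ltl D1 -> ltl D2 -> ltl (fun w => D1 w \/ D2 w).
Proof.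
move=> h1 h2.
apply: ltl_ext (ltl_not (ltl_and (ltl_not h1) (ltl_not h2))) => w.
by have [] := pselect (D1 w); have [] := pselect (D2 w); tauto.
Qed.

Lemma ltl_const (P : Prop) : ltl (fun _ : nat -> A => P).
Proof.
have [p|np] := pselect P.
  by apply: ltl_ext (ltl_true A) => w; tauto.
by apply: ltl_ext (ltl_not (ltl_true A)) => w; tauto.
Qed.

Lemma ltl_exists (I : finType) (D : I -> (nat -> A) -> Prop) :
  (forall i, ltl (D i)) -> ltl (fun w => exists i, D i w).
Proof.
move=> h.
suff hs (s : seq I) : ltl (fun w => exists2 i, i \in s & D i w).
  by apply: ltl_ext (hs (enum I)) => w; split=> [[i _]|[i]]; exists i => //; rewrite mem_enum.
elim: s => [|i s IH].
  by apply: ltl_ext (ltl_const False) => w; split => // -[].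
apply: ltl_ext (ltl_or (h i) IH) => w; split.
  by case=> [Di|[k ks Dk]]; [exists i; rewrite ?mem_head | exists k; rewrite // inE ks orbT].
by case=> k; rewrite inE => /orP[/eqP->|ks] Dk; [left | right; exists k].
Qed.

Lemma ltl_forall (I : finType) (D : I -> (nat -> A) -> Prop) :
  (forall i, ltl (D i)) -> ltl (fun w => forall i, D i w).
Proof.
move=> h; have := ltl_not (ltl_exists (fun i => ltl_not (h i))).
apply: ltl_ext => w; split=> [n i|p [i]]; last exact.
by apply: contrapT => ni; apply: n; exists i.
Qed.

Lemma ltl_head (P : A -> Prop) : ltl (fun w => P (w 0)).
Proof.
apply: ltl_ext (ltl_exists (fun a => ltl_and (ltl_const (P a)) (ltl_letter a))) => w.
by split=> [[a [Pa ->]]|p] //; exists (w 0).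
Qed.

Lemma ltl_iff D1 D2 : ltl D1 -> ltl D2 -> ltl (fun w => D1 w <-> D2 w).
Proof.
move=> h1 h2.
apply: ltl_ext (ltl_or (ltl_and h1 h2) (ltl_and (ltl_not h1) (ltl_not h2))) => w.
by have [] := pselect (D1 w); have [] := pselect (D2 w); tauto.
Qed.

End LTLClosure.

(** * Local divisors of aperiodic monoids *)

(* The laws are only required on the subset [S] of [M], so that a local divisor
   of [M] lives on the same carrier. *)
Record aperiodic_monoid (M : finType) (S : {set M}) (op : M -> M -> M) (e : M) : Prop :=
  AperiodicMonoid {
    am_unit : e \in S;
    am_closed : forall x y, x \in S -> y \in S -> op x y \in S;
    am_assoc : forall x y z, x \in S -> y \in S -> z \in S ->
      op x (op y z) = op (op x y) z;
    am_mul1 : forall x, x \in S -> op e x = x;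
    am_mulr1 : forall x, x \in S -> op x e = x;
    am_aper : exists N, forall x, x \in S -> iter N (op x) e = iter N.+1 (op x) e
  }.

Definition ev (A M : Type) (op : M -> M -> M) (e : M) (h : A -> M) (u : seq A) : M :=
  foldr (fun a x => op (h a) x) e u.

(** The subalphabet [B] allows letters to be removed one by one in an induction that keeps the type
    [A]. *)
Definition pre (A M : finType) (op : M -> M -> M) (e : M) (h : A -> M) (B : {set A})
    (m : M) (D : (nat -> A) -> Prop) (w : nat -> A) : Prop :=
  exists n, [/\ forall i, i < n -> w i \in B, ev op e h (mkseq w n) = m & D (shift n w)].

Section Evaluation.
Variables (M : finType) (S : {set M}) (op : M -> M -> M) (e : M).
Hypothesis am : aperiodic_monoid S op e.
Variables (A : finType) (B : {set A}) (h : A -> M).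
Hypothesis hS : forall a, a \in B -> h a \in S.

Lemma ev_in u : {subset u <= B} -> ev op e h u \in S.
Proof.
elim: u => [|a u IH] uB /=; first exact: am_unit am.
apply: (am_closed am); first by apply/hS/uB; rewrite mem_head.
by apply: IH => x xu; apply: uB; rewrite inE xu orbT.
Qed.

Lemma ev_cat u v : {subset u <= B} -> {subset v <= B} ->
  ev op e h (u ++ v) = op (ev op e h u) (ev op e h v).
Proof.
move=> + vB; elim: u => [|a u IH] uB /=; first by rewrite (am_mul1 am) // ev_in.
have u'B : {subset u <= B} by move=> x xu; apply: uB; rewrite inE xu orbT.
by rewrite IH // (am_assoc am) ?ev_in //; apply/hS/uB; rewrite mem_head.
Qed.

Lemma mkseq_sub (w : nat -> A) n : (forall i, i < n -> w i \in B) -> {subset mkseq w n <= B}.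
Proof. by move=> wB x /mapP[i]; rewrite mem_iota add0n => /wB ? ->. Qed.

End Evaluation.

Section LocalDivisor.
Variables (M : finType) (S : {set M}) (op : M -> M -> M) (e : M).
Hypothesis am : aperiodic_monoid S op e.
Variable c : M.
Hypothesis cS : c \in S.

Definition ld_set := [set x in S | [exists y in S, x == op c y] & [exists z in S, x == op z c]].
(** The product of the local divisor at [c]: [zc] times [cy] is [zcy]. The default [e] is taken only
    if the right factor has no factorisation [c z] with [z] in [S]. *)
Definition ld_op x y := op x (odflt e [pick z in S | y == op c z]).

Lemma ld_setP x : reflect
  [/\ x \in S, exists2 y, y \in S & x = op c y & exists2 z, z \in S & x = op z c]
  (x \in ld_set).
Proof.
rewrite inE; apply: (iffP and3P) => -[xS] => [/exists_inP[y yS /eqP e1] /exists_inP[z zS /eqP e2]|].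
  by split=> //; [exists y | exists z].
case=> y yS e1 [z zS e2]; split=> //; apply/exists_inP; [exists y|exists z] => //; exact/eqP.
Qed.

(** The choice made by [pick] is harmless: with [x = z c], the product [x y' = z (c y')] depends on
    [y'] only through [c y']. *)
Lemma ld_opE x y : x \in ld_set -> y \in S -> ld_op x (op c y) = op x y.
Proof.
move=> /ld_setP[xS _ [z zS xE]] yS; rewrite /ld_op; case: pickP => [y' /andP[y'S /eqP E]|].
  by rewrite /= xE -!(am_assoc am) // E.
by move/(_ y); rewrite yS eqxx.
Qed.

Lemma ld_sandwich t : t \in S -> op (op c t) c \in ld_set.
Proof.
move=> tS; have ctS := am_closed am cS tS; have tcS := am_closed am tS cS.
apply/ld_setP; split; [exact: am_closed am _ _ _ _| |by exists (op c t)].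
by exists (op t c); rewrite // (am_assoc am).
Qed.

Lemma ld_unit : c \in ld_set.
Proof.
have eS := am_unit am.
apply/ld_setP; split=> //; exists e => //; by rewrite ?(am_mulr1 am) ?(am_mul1 am).
Qed.

Lemma ld_aperiodic_monoid : aperiodic_monoid ld_set ld_op c.
Proof.
have eS := am_unit am.
have closed x y : x \in ld_set -> y \in ld_set -> ld_op x y \in ld_set.
  move=> xS' /ld_setP[yS [y1 y1S yE1] [y2 y2S yE2]].
  have /ld_setP[xS [x1 x1S xE1] [x2 x2S xE2]] := xS'.
  rewrite yE1 ld_opE //; apply/ld_setP; split; first exact: (am_closed am).
    by exists (op x1 y1); [exact: (am_closed am) | rewrite xE1 (am_assoc am)].
  exists (op x2 y2); first exact: (am_closed am).
  by rewrite xE2 -!(am_assoc am) // -yE1 yE2.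
split => //.
- exact: ld_unit.
- move=> x y z xS' yS' zS'.
  have /ld_setP[xS _ _] := xS'.
  have /ld_setP[yS [y1 y1S yE] _] := yS'; have /ld_setP[zS [z1 z1S zE] _] := zS'.
  have xyS' := closed _ _ xS' yS'.
  rewrite {1}zE (ld_opE yS') // {1}yE -(am_assoc am) // ld_opE //; last exact: (am_closed am).
  by rewrite zE ld_opE // yE ld_opE // (am_assoc am).
- move=> x /ld_setP[xS [x1 x1S ->] _]; rewrite ld_opE //; exact: ld_unit.
- move=> x xS'; have /ld_setP[xS _ _] := xS'.
  by rewrite -{1}(am_mulr1 am cS) ld_opE // (am_mulr1 am).
have [N HN] := am_aper am; exists N => x xS'.
have /ld_setP[xS [y yS xE] _] := xS'.
have pS n : iter n (op y) e \in S by elim: n => //= n IH; exact: (am_closed am).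
(* For [x = c y], powers in the local divisor are [c] times powers of [y], so the exponent [N] of
   the original monoid still works. *)
suff E n : iter n (ld_op x) c = op c (iter n (op y) e) by rewrite !E HN.
elim: n => [|n IH]; first by rewrite /= (am_mulr1 am).
by rewrite iterS IH ld_opE // xE -(am_assoc am).
Qed.

(** The unit [e] drops out: if [e = c y], then [c^n y^n = e] for all [n], and [c^N = c^(N+1)] gives
    [e = c^(N+1) y^N = c]. *)
Lemma ld_card : c != e -> #|ld_set| < #|S|.
Proof.
move=> ce; apply: proper_card; apply/properP; split.
  by apply/subsetP => x /ld_setP[].
exists e; first exact: am_unit am.
apply/negP => /ld_setP[eS [y yS E] _].
have [N HN] := am_aper am.
have cnS n : iter n (op c) e \in S by elim: n => //= n IH; exact: (am_closed am).
have ynS n : iter n (op y) e \in S by elim: n => //= n IH; exact: (am_closed am).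
have iterSr n : iter n.+1 (op c) e = op (iter n (op c) e) c.
  elim: n => [|n IH]; first by rewrite /= (am_mulr1 am) ?(am_mul1 am).
  by rewrite iterS {1}IH (am_assoc am).
have inv n : op (iter n (op c) e) (iter n (op y) e) = e.
  elim: n => [|n IH]; first by rewrite /= (am_mul1 am).
  rewrite iterSr [iter n.+1 (op y) e]iterS -(am_assoc am) ?(am_closed am) //.
  by rewrite (am_assoc am cS) // -E (am_mul1 am).
have : op c (op (iter N (op c) e) (iter N (op y) e)) = e.
  by rewrite (am_assoc am) // -iterS -HN.
by rewrite inv (am_mulr1 am) // => /eqP; apply/negP.
Qed.

End LocalDivisor.

(** * Cutting an infinite word at the occurrences of a letter *)

Section Jump.
Variables (A M : finType) (op : M -> M -> M) (e : M) (h : A -> M).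
Variables (c : A) (B : {set A}) (psi : (nat -> A) -> Prop).
(** The value 0 encodes that no later [c] exists and makes [jump] stay in place. *)
Definition gap (w : nat -> A) : nat :=
  if pselect (exists n, w n.+1 == c) is left ex then (ex_minn ex).+1 else 0.

Inductive gap_spec (w : nat -> A) : nat -> Prop :=
| GapSome n of w n.+1 = c & (forall i, i < n -> w i.+1 <> c) : gap_spec w n.+1
| GapNone of (forall n, w n.+1 <> c) : gap_spec w 0.

Lemma gapP w : gap_spec w (gap w).
Proof.
rewrite /gap; case: pselect => [ex|nex].
  case: ex_minnP => n /eqP wn min; constructor=> // i lt_in /eqP /min; lia.
by constructor=> n /eqP wn; apply: nex; exists n.
Qed.

Definition jump (w : nat -> A) := shift (gap w) w.

Definition at_c (w : nat -> A) := w 0 = c.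

(** For [c] outside [B]: the value of the factor up to the next [c], or [None] if no [c] follows or
    the factor leaves [B]. Phrasing it by [pre] over [B] makes it LTL-definable by induction on the
    alphabet. *)
Definition block (w : nat -> A) : option M :=
  [pick t | `[< pre op e h B t at_c (shift 1 w) >]].

Definition info (w : nat -> A) : option M * bool := (block w, `[< psi w >]).

(* After its last [c] the word is constant under [jump], so [proj] ends with a
   constant sequence of letters with first component [None]. *)
Definition proj (w : nat -> A) : nat -> option M * bool := fun j => info (iter j jump w).

Lemma proj_jump w : shift 1 (proj w) = proj (jump w).
Proof. by apply: funext => j; rewrite /shift /proj add1n iterSr. Qed.

Hypothesis cB : c \notin B.

(** As [c] is not in [B], a prefix over [B] that is followed by [c] can only end at the first
    [c]. *)
Lemma block_gap w t : pre op e h B t at_c (shift 1 w) <->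
  exists n, [/\ gap w = n.+1, forall i, i < n -> w i.+1 \in B &
                ev op e h (mkseq (shift 1 w) n) = t].
Proof.
split=> [[n [nB nt]]|[n [gn nB nt]]].
  rewrite shiftD add1n /at_c /shift addn0 => nc; exists n; split=> //.
  have {}nB i : i < n -> w i.+1 \in B by move=> /nB; rewrite /shift add1n.
  case: gapP => [k wk min|/(_ n)] //.
  have [|kn|-> //] := ltngtP k n; last by case: (min _ kn).
  by move/nB; rewrite wk (negPf cB).
exists n; split=> //.
  by rewrite shiftD add1n /at_c /shift addn0; move: gn; case: gapP => // k wk _ [<-].
Qed.

Lemma block_SomeP w t : block w = Some t <-> pre op e h B t at_c (shift 1 w).
Proof.
rewrite /block; case: pickP => [t' /asboolP p'|no].
  split=> [[<-] //|/block_gap[n [gn _ <-]]].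
  by move/block_gap: p' => [k []]; rewrite gn => -[<-] _ ->.
by split=> // p; have /asboolP := no t.
Qed.

Hypothesis ltl_block : forall t, ltl (pre op e h B t at_c).
Hypothesis ltl_psi : ltl psi.

(** When [w] starts with [c], positions of [proj w] are occurrences of [c] in [w], so temporal
    operators are relativised to these occurrences. The letters of [proj w] are definable by the
    hypotheses on blocks and on [psi]. *)
Lemma ltl_proj D : ltl D -> ltl (fun w => at_c w /\ D (proj w)).
Proof.
have lc : ltl at_c by exact: ltl_letter.
elim=> {D} [|ob|D _ IH|D1 D2 _ IH1 _ IH2|D _ IH|D1 D2 _ IH1 _ IH2].
- by apply: ltl_ext lc => w; tauto.
- case: ob => o b; apply: ltl_and => //.
  have lo : ltl (fun w => block w = o).
    have lS t : ltl (fun w => block w = Some t).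
      by apply: ltl_ext (ltl_next (ltl_block t)) => w; rewrite block_SomeP.
    case: o => [t|] //.
    apply: ltl_ext (ltl_not (ltl_exists lS)) => w.
    case: (block w) => [t|]; split=> // H; last by case.
    by case: H; exists t.
  apply: ltl_ext (ltl_and lo (ltl_iff ltl_psi (ltl_const A b))) => w.
  rewrite /proj /info /=; split=> [[-> E]|[-> <-]].
    by congr (_, _); apply/asboolP/idP => /E.
  by split=> //; split=> /asboolP.
- by apply: ltl_ext (ltl_and lc (ltl_not IH)) => w; tauto.
- by apply: ltl_ext (ltl_and IH1 IH2) => w; tauto.
(* A step of [proj w] goes to the next [c] of [w]; the second disjunct covers words without a later
   [c], where [proj w] repeats its letter. *)
- have hasn := ltl_next (ltl_until (ltl_true A) lc).
  apply: ltl_ext (ltl_and lc (ltl_or (ltl_next (ltl_until (ltl_not lc) IH))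
    (ltl_and (ltl_not hasn) IH))) => w; rewrite proj_jump.
  split=> -[wc H]; split=> //.
    case: H => [[n [[nc Dn] nmin]]|[H [_ Dw]]]; last first.
      rewrite /jump; move: H; case: gapP => [n wn _|]; last by rewrite shift0.
      by case; exists n; rewrite shiftD /at_c /shift /= addn0.
    suff -> : jump w = shift n (shift 1 w) by [].
    rewrite shiftD; congr (shift _ w); move: nc; rewrite shiftD /at_c /shift addn0 => nc.
    case: gapP => [k wk kmin|/(_ n)//]; rewrite add1n; congr _.+1.
    have [lt|lt|//] := ltngtP k n; last by case: (kmin n lt).
    by case: (nmin k lt); rewrite shiftD /at_c /shift addn0.
  move: H; rewrite /jump; case: gapP => [n wn nmin|no] Dw; [left|right].
    exists n; split; first by rewrite shiftD add1n; split=> //; rewrite /at_c /shift addn0.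
    by move=> i /nmin; rewrite shiftD /at_c /shift addn0.
  split; last by rewrite -[w in proj w]shift0.
  by case=> n [+ _]; rewrite shiftD /at_c /shift addn0; apply: no.
apply: ltl_ext (ltl_and lc (ltl_until (ltl_or (ltl_not lc) IH1) IH2)) => w.
split=> -[wc [j H]]; split=> //.
  (* From a position in [w] to a number of jumps: strong induction, as one jump skips a whole
     block. *)
  elim/ltn_ind: j w wc H => -[|j] IH w wc [].
    by rewrite shift0 => -[_ D2w] _; exists 0; rewrite shift0.
  rewrite {1}/at_c {1}/shift addn0 => -[wj D2w] min.
  have D1w : D1 (proj w) by case: (min 0 isT); rewrite shift0 => // -[].
  have := gapP w; case E : _ / => [n wn nmin|/(_ j) //].
  have le_nj : n <= j by rewrite leqNgt; apply/negP => /nmin.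
  have lt_j : j - n < j.+1 by lia.
  have [||k [D2k D1k]] := IH _ lt_j (jump w).
  - by rewrite /at_c /jump E /shift addn0.
  - rewrite /jump E; split=> [|i lt_i].
      rewrite shiftD; have -> : n.+1 + (j - n) = j.+1 by lia.
      by rewrite /at_c {1}/shift addn0.
    by rewrite shiftD; apply: min; lia.
  exists k.+1; split=> [|[|i] lt_i]; rewrite -?proj_jump.
  - by rewrite -addn1 addnC -shiftD proj_jump.
  - by rewrite shift0.
  - by rewrite -addn1 addnC -shiftD proj_jump; apply: D1k.
elim: j w wc H => [|j IH] w wc [].
  by rewrite shift0 => D2w _; exists 0; rewrite shift0.
rewrite -addn1 addnC -shiftD proj_jump => D2w min.
have D1w : D1 (proj w) by have := min 0 isT; rewrite shift0.
have [] := IH (jump w).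
- by rewrite /at_c /jump; case: gapP => [n|]; rewrite /shift addn0.
- split=> // i lt_i; rewrite -proj_jump shiftD; exact: min.
rewrite /jump; case: gapP => [n wn nmin|no] m [D2m D1m]; last first.
  by exists m; split=> [|i /D1m]; rewrite ?shift0 // in D2m *.
exists (n.+1 + m); rewrite -shiftD; split=> // i lt_i.
have [le|lt] := leqP n.+1 i.
  have -> : i = n.+1 + (i - n.+1) by lia.
  by rewrite -shiftD; apply: D1m; lia.
case: i lt {lt_i} => [|i] lt; first by right; rewrite shift0.
by left; rewrite /at_c /shift addn0; apply: nmin.
Qed.

End Jump.

(** * Evaluating the cut word in the local divisor *)

Section LocalDivisorWords.
Variables (M : finType) (S : {set M}) (op : M -> M -> M) (e : M).
Hypothesis am : aperiodic_monoid S op e.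
Variables (A : finType) (h : A -> M) (B : {set A}) (c : A).
Hypothesis hS : forall a, a \in B -> h a \in S.
Hypothesis cB : c \in B.

Definition ld_letter (o : option M * bool) : M :=
  if o.1 is Some t then op (op (h c) t) (h c) else h c.

(** Leaving out [None] forces a prefix over this alphabet to cross only blocks that are closed by a
    further [c]. *)
Definition ld_alphabet : {set option M * bool} :=
  [set o | if o.1 is Some t then t \in S else false].

Lemma ld_letter_in o : o \in ld_alphabet -> ld_letter o \in ld_set S op (h c).
Proof.
by rewrite inE /ld_letter; case: o.1 => // t; apply: (ld_sandwich am); apply: hS.
Qed.

Let evB (w : nat -> A) n : (forall i, i < n -> w i \in B) -> ev op e h (mkseq w n) \in S.
Proof. by move=> wB; apply: (ev_in am hS); apply: mkseq_sub. Qed.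

Let ev_mkseqD (w : nat -> A) m n : (forall i, i < m + n -> w i \in B) ->
  ev op e h (mkseq w (m + n)) = op (ev op e h (mkseq w m)) (ev op e h (mkseq (shift m w) n)).
Proof.
move=> wB; rewrite mkseqD (ev_cat am hS) //; apply: mkseq_sub => i lt_i; apply: wB; lia.
Qed.

Variable psi : (nat -> A) -> Prop.
Let pr := proj op e h c (B :\ c) psi.
Let ld_pre q := pre (ld_op S op e (h c)) (h c) ld_letter ld_alphabet q
                    (fun v : nat -> option M * bool => (v 0).2).

Lemma c_notin : c \notin B :\ c. Proof. by rewrite !inE eqxx. Qed.

(* One block [c u] with [u] free of [c] contributes [h c * t * h c] to the local
   divisor, where [t] is the value of [u]. *)
Let ld_ev_step (w : nat -> A) n k : w 0 = c -> w n.+1 = c ->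
    (forall i, i < n.+1 + k.+1 -> w i \in B) ->
  ld_op S op e (h c) (op (op (h c) (ev op e h (mkseq (shift 1 w) n))) (h c))
    (ev op e h (mkseq (shift n.+1 w) k.+1)) = ev op e h (mkseq w (n.+1 + k.+1)).
Proof.
move=> w0 wn wB; have hcS := hS cB; rewrite ev_mkseqD // !mkseqS1 /=.
have -> : shift n.+1 w 0 = c by rewrite /shift addn0.
rewrite w0 shiftD.
have tS : ev op e h (mkseq (shift 1 w) n) \in S by apply: evB => i lt_i; apply: wB; lia.
have yS : ev op e h (mkseq (shift (n.+1 + 1) w) k) \in S.
  by apply: evB => i lt_i; apply: wB; lia.
rewrite (ld_opE am) // ?(am_assoc am) ?(am_closed am) //; exact: (ld_sandwich am).
Qed.

(** In the local divisor the letters [c t1 c], [c t2 c], ... multiply to [c t1 c t2 c ...], the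
    value in [M] of the factor from the first to the last [c] reached; the empty product is [h c],
    the value of a lone [c]. The boolean component tells whether [psi] holds at that last [c]. *)
Lemma ld_pre_proj w q : w 0 = c -> ld_pre q (pr w) <->
  exists n, [/\ w n = c, forall i, i <= n -> w i \in B,
                ev op e h (mkseq w n.+1) = q & psi (shift n w)].
Proof.
have hcS := hS cB; have blk := block_gap op e h c_notin.
have prE v : pr v 0 = (block op e h c (B :\ c) v, `[< psi v >]) by [].
move=> w0; split.
  case=> j; elim: j w q w0 => [|j IH] w q w0 [jB jq jF].
    exists 0; split=> //.
    - by case=> // _; rewrite w0.
    - by rewrite -jq /= w0 (am_mulr1 am).
    by move: jF; rewrite !shift0 => /asboolP.
  have := jB 0 isT; rewrite inE prE.
  case Eb : block => [t|] // tS.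
  have /blk[n [gn nB nt]] := (block_SomeP op e h c_notin w t).1 Eb.
  have jE : jump c w = shift n.+1 w by rewrite /jump gn.
  have wn : w n.+1 = c by move: gn; case: gapP => // k wk _ [<-].
  have [||k [wk kB kq kF]] := IH (jump c w) (ev (ld_op S op e (h c)) (h c) ld_letter
                                  (mkseq (pr (jump c w)) j)).
  - by rewrite jE /shift addn0.
  - rewrite /pr -proj_jump; split=> // i lt_i.
    by rewrite /shift add1n; apply: jB.
  rewrite jE in wk kB kF kq.
  have wB i : i < n.+1 + k.+1 -> w i \in B.
    move=> lt_i; have [le|lt] := leqP n.+1 i.
      have := kB (i - n.+1); rewrite /shift subnKC //; apply; lia.
    by case: i lt {lt_i} => [|i] lt; [rewrite w0 | case/setD1P: (nB i lt)].
  exists (n.+1 + k); split=> //.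
  - by move=> i lt_i; apply: wB; lia.
  - rewrite -addnS -ld_ev_step // nt kq -jq mkseqS1 /= proj_jump.
    by rewrite /ld_letter /pr {2}/proj /info /= Eb jE.
  by rewrite -shiftD.
case=> n; elim/ltn_ind: n w q w0 => n IH w q w0 [wn nB nq nF].
case: n IH wn nB nq nF => [|n] IH wn nB nq nF.
  exists 0; split=> //; first by rewrite -nq /= w0 (am_mulr1 am).
  by rewrite !shift0 in nF *; apply/asboolP.
have := gapP c w; case E : _ / => [k wk kmin|/(_ n) //].
have le_kn : k <= n by rewrite leqNgt; apply/negP => /kmin.
have jE : jump c w = shift k.+1 w by rewrite /jump -E.
have kn : k.+1 + (n - k) = n.+1 by lia.
have kB i : i < k -> w i.+1 \in B :\ c.
  by move=> lt_i; rewrite !inE nB ?andbT; [apply/eqP/kmin | lia].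
have Eb : block op e h c (B :\ c) w = Some (ev op e h (mkseq (shift 1 w) k)).
  by apply/(block_SomeP op e h c_notin)/blk; exists k.
have lt_n : n - k < n.+1 by lia.
have [||j [jB jq jF]] := IH _ lt_n (jump c w) (ev op e h (mkseq (shift k.+1 w) (n - k).+1)).
- by rewrite jE /shift addn0.
- rewrite jE shiftD kn; split=> // [|i lt_i]; first by rewrite /shift kn.
  by apply: nB; lia.
exists j.+1; split.
- case=> [_|i lt_i].
    rewrite inE /pr /proj /info /= Eb.
    by apply: evB => i lt_i; apply: nB; rewrite add1n; lia.
  have -> : pr w i.+1 = shift 1 (pr w) i by [].
  by rewrite /pr proj_jump; apply: jB.
- rewrite mkseqS1 /= proj_jump jq -nq -kn -addnS -ld_ev_step //.
  - by rewrite /ld_letter /pr /proj /info /= Eb.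
  - by move=> i lt_i; apply: nB; lia.
by rewrite -addn1 addnC -shiftD proj_jump.
Qed.

(* A prefix over [B] either avoids [c] or is cut at its first and its last [c]. *)
Lemma pre_split m D w (psi_r : M -> (nat -> A) -> Prop) :
    (forall r v, psi_r r v <-> pre op e h (B :\ c) r D (shift 1 v)) ->
  pre op e h B m D w <-> pre op e h (B :\ c) m D w \/
  exists pqr : M * M * M, op pqr.1.1 (op pqr.1.2 pqr.2) = m /\
    pre op e h (B :\ c) pqr.1.1 (fun v => v 0 = c /\
      exists n, [/\ v n = c, forall i, i <= n -> v i \in B,
        ev op e h (mkseq v n.+1) = pqr.1.2 & psi_r pqr.2 (shift n v)]) w.
Proof.
move=> psiE; split.
  case=> n [nB nm nD].
  have [noc|] := pselect (forall i, i < n -> w i <> c).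
    left; exists n; split=> // i lt_i; rewrite !inE nB // andbT; exact/eqP/noc.
  move=> hasc; right.
  have exc : exists i, (i < n) && (w i == c).
    apply: contrapT => no; apply: hasc => i lt_i wi.
    by apply: no; exists i; rewrite lt_i wi eqxx.
  have bnd i : (i < n) && (w i == c) -> i <= n by case/andP => /ltnW.
  (* [a] and [b] are the first and last [c] of the prefix; the triple consists of the values before
     [a], from [a] to [b] inclusive, and after [b]. *)
  case: (ex_minnP exc) => a /andP[lt_an /eqP wa] amin.
  case: (ex_maxnP exc bnd) => b /andP[lt_bn /eqP wb] bmax.
  have le_ab : a <= b by apply: amin; rewrite lt_bn wb eqxx.
  have nE : n = a + ((b - a).+1 + (n - b.+1)) by lia.
  exists (ev op e h (mkseq w a), ev op e h (mkseq (shift a w) (b - a).+1),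
          ev op e h (mkseq (shift b.+1 w) (n - b.+1))); split=> /=.
    rewrite -nm {2}nE ev_mkseqD -?nE // ev_mkseqD ?shiftD; last first.
      by move=> i lt_i; apply: nB; lia.
    by have -> : a + (b - a).+1 = b.+1 by lia.
  exists a; split=> // [i lt_i|].
    rewrite !inE nB ?andbT; last by lia.
    apply/eqP => wi; suff : a <= i by lia.
    by apply: amin; apply/andP; split; [lia | exact/eqP].
  split; first by rewrite /shift addn0.
  have ba : a + (b - a) = b by lia.
  exists (b - a); split=> // [|i lt_i|]; first by rewrite /shift ba.
    by apply: nB; lia.
  apply/psiE; rewrite !shiftD addnA ba addn1; exists (n - b.+1); split=> // [i lt_i|].
    rewrite !inE nB ?andbT; last by lia.
    apply/eqP => wi; suff : b.+1 + i <= b by lia.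
    by apply: bmax; apply/andP; split; [lia | exact/eqP].
  by rewrite shiftD; have -> : b.+1 + (n - b.+1) = n by lia.
have sub i (v : nat -> A) : v i \in B :\ c -> v i \in B by case/setD1P.
case=> [[n [nB nm nD]]|[[[p q] r] /= [<- [a [aB <- [v0 [n [vn vB <- /psiE]]]]]]]].
  by exists n; split=> // i /nB /sub.
rewrite !shiftD addn1 => -[k [kB <- kD]].
have wB i : i < a + (n.+1 + k) -> w i \in B.
  move=> lt_i; have [lt|le] := ltnP i a; first exact/sub/aB.
  have [lt'|le'] := leqP i (a + n).
    have -> : i = a + (i - a) by lia.
    by apply: vB; lia.
  have -> : i = (a + n.+1) + (i - (a + n.+1)) by lia.
  by apply: (sub); apply: kB; lia.
exists (a + (n.+1 + k)); split=> //; last first.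
  by move: kD; rewrite shiftD; have -> : (a + n.+1) + k = a + (n.+1 + k) by lia.
rewrite ev_mkseqD // ev_mkseqD ?shiftD ?addnS //.
by move=> i lt_i; apply: wB; lia.
Qed.

End LocalDivisorWords.

(** Nested induction on the sizes of [S] and [B]. For a letter [c] of [B] with value other than [e],
    the outer factors of [pre_split] avoid [c] and use the smaller alphabet, while the middle one is
    a prefix of [proj] evaluated in the smaller local divisor at [h c]. *)
Theorem ltl_pre (A M : finType) (S : {set M}) (op : M -> M -> M) (e : M) (h : A -> M)
    (B : {set A}) (m : M) (D : (nat -> A) -> Prop) :
  aperiodic_monoid S op e -> (forall a, a \in B -> h a \in S) -> ltl D ->
  ltl (pre op e h B m D).
Proof.
have [s] := ubnP #|S|; elim: s => // s IHs in A S op e h B m D * => /ltnSE leS am.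
have [b] := ubnP #|B|; elim: b => // b IHb in B m D * => /ltnSE leB hS lD.
have [[c /andP[cB hc]]|triv] := pselect (exists c, (c \in B) && (h c != e)); last first.
  have {}triv a : a \in B -> h a = e.
    move=> aB; apply/eqP; apply: contrapT => /negP ha.
    by apply: triv; exists a; rewrite aB.
  have evE w n : (forall i, i < n -> w i \in B) -> ev op e h (mkseq w n) = e.
    elim: n w => // n IH w wB; rewrite mkseqS1 /= triv ?wB // IH ?(am_mul1 am) ?(am_unit am) //.
    by move=> i lt_i; apply: wB; rewrite add1n.
  (* All prefixes over [B] have value [e], so a single until suffices. *)
  apply: ltl_ext (ltl_and (ltl_const A (e = m))
    (ltl_until (ltl_head (fun a => a \in B)) lD)) => w.
  split=> [[<- [n [nD nB]]]|[n [nB <- nD]]].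
    have {}nB i : i < n -> w i \in B by move/nB; rewrite /shift addn0.
    by exists n; split=> //; apply: evE.
  split; first by rewrite evE.
  by exists n; split=> // i /nB; rewrite /shift addn0.
have hS' a : a \in B :\ c -> h a \in S by case/setD1P => _; apply: hS.
have lB q D' : ltl D' -> ltl (pre op e h (B :\ c) q D').
  by apply: IHb => //; move: leB; rewrite [#|B|](cardsD1 c) cB.
have hcS := hS _ cB.
have lpsi r := ltl_next (lB r D lD).
have := fun pqr : M * M * M => lB pqr.1.1 _
  (ltl_proj (c_notin B c) (fun t => lB t _ (ltl_letter c)) (lpsi pqr.2)
    (IHs _ _ _ _ (ld_letter op h c) (ld_alphabet S) pqr.1.2 _
       (leq_trans (ld_card am hcS hc) leS) (ld_aperiodic_monoid am hcS)
       (ld_letter_in am hS cB) (ltl_head (fun o : option M * bool => o.2)))).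
move=> H.
apply: ltl_ext (ltl_or (lB m D lD) (ltl_exists (fun pqr =>
   ltl_and (ltl_const A (op pqr.1.1 (op pqr.1.2 pqr.2) = m)) (H pqr)))) => w.
rewrite (pre_split am hS cB _ _ (fun r v => iff_refl _)).
suff E (pqr : M * M * M) v : at_c c v /\
     pre (ld_op S op e (h c)) (h c) (ld_letter op h c) (ld_alphabet S) pqr.1.2 (fun w => (w 0).2) (proj op e h c (B :\ c)
       (fun w => pre op e h (B :\ c) pqr.2 D (shift 1 w)) v) <-> v 0 = c /\
      (exists n, [/\ v n = c, forall i, i <= n -> v i \in B,
        ev op e h (mkseq v n.+1) = pqr.1.2 & pre op e h (B :\ c) pqr.2 D (shift 1 (shift n v))]).
  by split=> -[?|[pqr [? p]]]; [left | right | left | right] => //; exists pqr; split=> //;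
     move: p; have /predeqP -> := E pqr.
have E := @ld_pre_proj _ _ _ _ am _ _ _ _ hS cB
  (fun w => pre op e h (B :\ c) pqr.2 D (shift 1 w)) v pqr.1.2.
by split=> -[v0 H']; split=> //; apply/(E v0).
Qed.

(** * First-order types of words *)

Lemma cat_eq_cat_cons (T : Type) (u v x y : seq T) a : u ++ v = x ++ a :: y ->
  (exists2 z, u = x ++ a :: z & y = z ++ v) \/ (exists2 z, x = u ++ z & v = z ++ a :: y).
Proof.
elim: u x => [|b u IH] [|d x] /=; first by right; exists [::].
- by right; exists (d :: x).
- by case=> -> <-; left; exists u.
case=> -> /IH[[z -> ->]|[z -> ->]]; [left|right]; by exists z.
Qed.

Lemma map_eq_cat_cons (T U : Type) (f : T -> U) u x b y : map f u = x ++ b :: y ->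
  exists x' a y', [/\ u = x' ++ a :: y', map f x' = x, f a = b & map f y' = y].
Proof.
elim: u x => [|a u IH] [|d x] //= [].
  by move=> <- <-; exists [::], a, u.
by move=> <- /IH[x' [a' [y' [-> <- <- <-]]]]; exists (a :: x'), a', y'.
Qed.

Fixpoint ty (A : finType) (k : nat) : finType :=
  if k is k'.+1 then {set ty A k' * A * ty A k'} else unit.

(* The first-order type of a finite word: a move of the Ehrenfeucht-Fraisse game
   cuts the word at one letter, after which the two halves are independent. *)
Fixpoint tp (A : finType) k (u : seq A) : ty A k :=
  match k return ty A k with
  | 0 => tt
  | k'.+1 => [set t | `[< exists u1 a u2,
                u = u1 ++ a :: u2 /\ t = (tp k' u1, a, tp k' u2) >]]
  end.

Fixpoint otp (A : finType) k (w : nat -> A) : ty A k :=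
  match k return ty A k with
  | 0 => tt
  | k'.+1 => [set t | `[< exists n, t = (tp k' (mkseq w n), w n, otp k' (shift n.+1 w)) >]]
  end.

Section Types.
Variable A : finType.
Implicit Types (u v : seq A) (w : nat -> A).

Lemma mem_tp k u (t : ty A k * A * ty A k) : reflect
  (exists u1 a u2, u = u1 ++ a :: u2 /\ t = (tp k u1, a, tp k u2)) (t \in tp k.+1 u).
Proof. by rewrite inE; apply: asboolP. Qed.

Lemma mem_otp k w (t : ty A k * A * ty A k) : reflect
  (exists n, t = (tp k (mkseq w n), w n, otp k (shift n.+1 w))) (t \in otp k.+1 w).
Proof. by rewrite inE; apply: asboolP. Qed.

Lemma tp_cut k u v u1 a u2 : tp k.+1 u = tp k.+1 v -> u = u1 ++ a :: u2 ->
  exists v1 v2, [/\ v = v1 ++ a :: v2, tp k u1 = tp k v1 & tp k u2 = tp k v2].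
Proof.
move=> E uE; have : (tp k u1, a, tp k u2) \in tp k.+1 v.
  by rewrite -E; apply/mem_tp; exists u1, a, u2.
by case/mem_tp => [v1 [b [v2 [vE [E1 -> E2]]]]]; exists v1, v2.
Qed.

Lemma tp_subset k u v :
  (forall u1 a u2, u = u1 ++ a :: u2 ->
     exists v1 v2, [/\ v = v1 ++ a :: v2, tp k u1 = tp k v1 & tp k u2 = tp k v2]) ->
  tp k.+1 u \subset tp k.+1 v.
Proof.
move=> H; apply/subsetP => t /mem_tp[u1 [a [u2 [/H[v1 [v2 [-> -> ->]]] ->]]]].
by apply/mem_tp; exists v1, a, v2.
Qed.

Lemma otp_cut k w w' n : otp k.+1 w = otp k.+1 w' ->
  exists n', [/\ w n = w' n', tp k (mkseq w n) = tp k (mkseq w' n') &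
                 otp k (shift n.+1 w) = otp k (shift n'.+1 w')].
Proof.
move=> E; have : (tp k (mkseq w n), w n, otp k (shift n.+1 w)) \in otp k.+1 w'.
  by rewrite -E; apply/mem_otp; exists n.
by case/mem_otp => [n' [E1 E2 E3]]; exists n'.
Qed.

Lemma otp_subset k w w' :
  (forall n, exists n', [/\ w n = w' n', tp k (mkseq w n) = tp k (mkseq w' n') &
                 otp k (shift n.+1 w) = otp k (shift n'.+1 w')]) ->
  otp k.+1 w \subset otp k.+1 w'.
Proof.
move=> H; apply/subsetP => t /mem_otp[n ->].
by have [n' [-> -> ->]] := H n; apply/mem_otp; exists n'.
Qed.

Lemma tp_pred k u v : tp k.+1 u = tp k.+1 v -> tp k u = tp k v.
Proof.
elim: k u v => // k IH; suff H u v : tp k.+2 u = tp k.+2 v -> tp k.+1 u \subset tp k.+1 v.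
  by move=> u v E; apply/eqP; rewrite eqEsubset !H.
move=> E; apply: tp_subset => u1 a u2 /(tp_cut E)[v1 [v2 [-> /IH -> /IH ->]]].
by exists v1, v2.
Qed.

Lemma otp_pred k w w' : otp k.+1 w = otp k.+1 w' -> otp k w = otp k w'.
Proof.
elim: k w w' => // k IH; suff H w w' : otp k.+2 w = otp k.+2 w' -> otp k.+1 w \subset otp k.+1 w'.
  by move=> w w' E; apply/eqP; rewrite eqEsubset !H.
move=> E; apply: otp_subset => n; have [n' [wn /tp_pred E1 /IH E2]] := otp_cut n E.
by exists n'.
Qed.

(** A cut of [u ++ v] falls into one of the factors and is answered there, while the other factor is
    carried along at the lower rank by [tp_pred]. *)
Lemma tp_cat k u u' v v' : tp k u = tp k u' -> tp k v = tp k v' ->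
  tp k (u ++ v) = tp k (u' ++ v').
Proof.
elim: k u u' v v' => // k IH.
suff H u u' v v' : tp k.+1 u = tp k.+1 u' -> tp k.+1 v = tp k.+1 v' ->
    tp k.+1 (u ++ v) \subset tp k.+1 (u' ++ v').
  by move=> u u' v v' E1 E2; apply/eqP; rewrite eqEsubset !H.
move=> E1 E2; apply: tp_subset => u1 a u2 /(@cat_eq_cat_cons A)[[z uE ->]|[z -> vE]].
  have [u1' [u2' [-> F1 F2]]] := tp_cut E1 uE.
  by exists u1', (u2' ++ v'); rewrite -catA; split=> //; apply: IH => //; apply: tp_pred.
have [v1' [v2' [-> F1 F2]]] := tp_cut E2 vE.
by exists (u' ++ v1'), v2'; rewrite -catA; split=> //; apply: IH => //; apply: tp_pred.
Qed.

Lemma otp_cat k w w' n n' : tp k (mkseq w n) = tp k (mkseq w' n') ->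
  otp k (shift n w) = otp k (shift n' w') -> otp k w = otp k w'.
Proof.
elim: k w w' n n' => // k IH.
suff H w w' n n' : tp k.+1 (mkseq w n) = tp k.+1 (mkseq w' n') ->
    otp k.+1 (shift n w) = otp k.+1 (shift n' w') -> otp k.+1 w \subset otp k.+1 w'.
  move=> w w' n n' E1 E2; apply/eqP; rewrite eqEsubset.
  by apply/andP; split; [apply: H E1 E2 | apply: H (esym E1) (esym E2)].
move=> E1 E2; apply: otp_subset => m; have [le_nm|lt_mn] := leqP n m.
  have mE : m = n + (m - n) by lia.
  have [j [F1 F2 F3]] := otp_cut (m - n) E2.
  exists (n' + j); rewrite mE; split; first exact: F1.
    by rewrite !mkseqD; apply: tp_cat => //; apply: tp_pred.
  by move: F3; rewrite !shiftD !addnS.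
have nE : n = m + (n - m.+1).+1 by lia.
have [x' [y' [wE F1 F2]]] : exists x' y', [/\ mkseq w' n' = x' ++ w m :: y',
    tp k (mkseq w m) = tp k x' & tp k (mkseq (shift m.+1 w) (n - m.+1)) = tp k y'].
  by apply: tp_cut E1 _; rewrite {1}nE mkseqD mkseqS1 shiftD addn1 /shift addn0.
set m' := size x' in wE *.
have n'E : n' = m' + (n' - m'.+1).+1.
  by have := congr1 size wE; rewrite size_mkseq size_cat /= -/m'; lia.
move: wE; rewrite {1}n'E mkseqD mkseqS1 shiftD addn1 /shift addn0 => /eqP.
rewrite eqseq_cat ?size_mkseq // eqseq_cons => /and3P[/eqP xE /eqP aE /eqP yE].
exists m'; split=> //; first by rewrite xE.
apply: (IH _ _ (n - m.+1) (n' - m'.+1)); first by rewrite F2 -yE.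
apply: otp_pred; rewrite !shiftD.
have -> : m.+1 + (n - m.+1) = n by lia.
by have -> : m'.+1 + (n' - m'.+1) = n' by lia.
Qed.

(** One round tells the empty word apart; this makes the successor relation visible to the game. *)
Lemma tp_nil k u : tp k.+1 u = tp k.+1 [::] -> u = [::].
Proof.
case: u => // a u E.
by have [[|? ?] [? [? _ _]]] := tp_cut (u1 := [::]) E erefl.
Qed.

Definition pow u n : seq A := flatten (nseq n u).

Lemma powD u m n : pow u (m + n) = pow u m ++ pow u n.
Proof. by rewrite /pow nseqD flatten_cat. Qed.

Lemma pow_cut u n x a y : pow u n = x ++ a :: y -> exists i x' y',
  [/\ i < n, u = x' ++ a :: y', x = pow u i ++ x' & y = y' ++ pow u (n - i.+1)].
Proof.
elim: n x => [|n IH] x; first by case: x.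
rewrite /pow /= -/(pow u n) => /(@cat_eq_cat_cons A)[[z uE ->]|[z -> /IH]].
  by exists 0, x, z; rewrite subSS subn0.
case=> i [x' [y' [lt_i uE -> ->]]]; exists i.+1, x', y'; split=> //.
by rewrite /pow /= -catA.
Qed.

Lemma pow_uncut u x a y i j : u = x ++ a :: y ->
  pow u (i + j.+1) = (pow u i ++ x) ++ a :: (y ++ pow u j).
Proof. by move=> uE; rewrite powD -[j.+1]add1n powD {2}/pow /= cats0 {2}uE -!catA. Qed.

(** A cut inside one copy of [u] leaves enough copies on one side for the bound of the next lower
    rank, and that side gains or loses a copy by induction. This is the aperiodicity of the monoid
    of types. *)
Lemma tp_pow k u n : 2 ^ k <= n.+1 -> tp k (pow u n) = tp k (pow u n.+1).
Proof.
elim: k n => // k IH n; rewrite expnS => le_n.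
apply/eqP; rewrite eqEsubset; apply/andP; split; apply: tp_subset => x a y.
  case/pow_cut=> i [x' [y' [lt_i uE -> ->]]].
  have [le_i|lt_i'] := leqP (2 ^ k) i.+1.
    exists (pow u i.+1 ++ x'), (y' ++ pow u (n - i.+1)); split=> //.
      by rewrite -(pow_uncut _ _ uE); congr pow; lia.
    by apply: tp_cat => //; apply: IH.
  exists (pow u i ++ x'), (y' ++ pow u (n - i)); split=> //.
    by rewrite -(pow_uncut _ _ uE); congr pow; lia.
  have -> : n - i = (n - i.+1).+1 by lia.
  by apply: tp_cat => //; apply: IH; lia.
case/pow_cut=> i [x' [y' [lt_i uE -> ->]]].
have [le_i|lt_i'] := leqP (2 ^ k) i.
  have Ei : i = i.-1.+1 by have := expn_gt0 2 k; lia.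
  exists (pow u i.-1 ++ x'), (y' ++ pow u (n - i)); split=> //.
    by rewrite -(pow_uncut _ _ uE); congr pow; lia.
  by apply: tp_cat => //; rewrite {1}Ei; apply/esym/IH; lia.
exists (pow u i ++ x'), (y' ++ pow u (n - i.+1)); split=> //.
  by rewrite -(pow_uncut _ _ uE); congr pow; lia.
have -> : n.+1 - i.+1 = (n - i.+1).+1 by lia.
by apply: tp_cat => //; apply/esym/IH; lia.
Qed.

(** Types are multiplied through representatives; the empty word is the default for elements of
    [ty A k] that are the type of no word. *)
Definition ty_word k (t : ty A k) : seq A :=
  if pselect (exists u, t = tp k u) is left ex then projT1 (cid ex) else [::].

Definition ty_op k (s t : ty A k) : ty A k := tp k (ty_word s ++ ty_word t).

Lemma ty_opE k u v : ty_op (tp k u) (tp k v) = tp k (u ++ v).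
Proof.
have wordE x : tp k (ty_word (tp k x)) = tp k x.
  by rewrite /ty_word; case: pselect => [ex|[]]; [case: (cid ex) | exists x].
exact: tp_cat.
Qed.

Definition ty_real k : {set ty A k} := [set t | `[< exists u, t = tp k u >]].

Lemma ty_realP k t : reflect (exists u, t = tp k u) (t \in ty_real k).
Proof. by rewrite inE; apply: asboolP. Qed.

Lemma ty_aperiodic_monoid k : aperiodic_monoid (ty_real k) (@ty_op k) (tp k [::]).
Proof.
split.
- by apply/ty_realP; exists [::].
- by move=> _ _ /ty_realP[u ->] /ty_realP[v ->]; apply/ty_realP; exists (u ++ v); rewrite ty_opE.
- move=> _ _ _ /ty_realP[x ->] /ty_realP[y ->] /ty_realP[z ->].
  by rewrite !ty_opE catA.
- by move=> _ /ty_realP[x ->]; rewrite ty_opE.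
- by move=> _ /ty_realP[x ->]; rewrite ty_opE cats0.
exists (2 ^ k) => _ /ty_realP[u ->].
have E n : iter n (ty_op (tp k u)) (tp k [::]) = tp k (pow u n).
  by elim: n => //= n ->; rewrite ty_opE.
by rewrite !E; apply: tp_pow.
Qed.

Lemma ev_tp k u : ev (@ty_op k) (tp k [::]) (fun a : A => tp k [:: a]) u = tp k u.
Proof. by elim: u => //= a u ->; rewrite ty_opE. Qed.

(** Kamp's theorem for types. A triple [(q1, a, q2)] belongs to the type iff some prefix of type
    [q1] is followed by [a] and a suffix of type [q2], an instance of [pre] for the monoid of types;
    finitely many such conditions fix the type. *)
Lemma ltl_otp k (t : ty A k) : ltl (fun w : nat -> A => otp k w = t).
Proof.
elim: k t => [|k IH] t; first exact: (ltl_const A (tt = t :> ty A 0)).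
have step (q : ty A k * A * ty A k) : ltl (fun w => q \in otp k.+1 w).
  have := @ltl_pre A _ _ _ _ _ setT q.1.1 _ (ty_aperiodic_monoid k)
    (fun a _ => introT (ty_realP _) (ex_intro _ [:: a] erefl))
    (ltl_and (ltl_letter q.1.2) (ltl_next (IH q.2))).
  apply: ltl_ext => w; split.
    case=> n [_ wn [w0 wE]]; apply/mem_otp; exists n; case: q wn w0 wE => [[q1 a] q2] /=.
    by rewrite ev_tp shiftD addn1 /shift addn0 => -> -> ->.
  move/mem_otp=> [n ->]; exists n; split=> //; first exact: ev_tp.
  by rewrite shiftD addn1 /shift addn0.
apply: ltl_ext (ltl_forall (fun q => ltl_iff (step q) (ltl_const A (q \in t)))) => w.
split=> [H|-> q]; last by split.
by apply/setP => q; apply/idP/idP; [exact: (H q).1 | exact: (H q).2].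
Qed.

End Types.

Lemma tp_map (A A' : finType) (f : A -> A') k u v :
  tp k u = tp k v -> tp k (map f u) = tp k (map f v).
Proof.
elim: k u v => // k IH.
suff H u v : tp k.+1 u = tp k.+1 v -> tp k.+1 (map f u) \subset tp k.+1 (map f v).
  by move=> u v E; apply/eqP; rewrite eqEsubset !H.
move=> E; apply: tp_subset => u1 a u2 /(@map_eq_cat_cons A A')[x [b [y [uE <- <- <-]]]].
have [x' [y' [-> F1 F2]]] := tp_cut E uE.
by exists (map f x'), (map f y'); rewrite map_cat; split=> //; apply: IH.
Qed.

Lemma otp_map (A A' : finType) (f : A -> A') k w w' :
  otp k w = otp k w' -> otp k (f \o w) = otp k (f \o w').
Proof.
elim: k w w' => // k IH.
suff H w w' : otp k.+1 w = otp k.+1 w' -> otp k.+1 (f \o w) \subset otp k.+1 (f \o w').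
  by move=> w w' E; apply/eqP; rewrite eqEsubset !H.
move=> E; apply: otp_subset => n; have [n' [F1 F2 /IH F3]] := otp_cut n E.
exists n'; split=> //; first by rewrite /= F1.
have comp v m : mkseq (f \o v) m = map f (mkseq v m) by rewrite /mkseq -map_comp.
by rewrite !comp; apply: tp_map.
Qed.

(** * Words with marked positions *)

(** Open at both ends: the letters at marks are compared separately in [equ]. *)
Definition seg (A : Type) (w : nat -> A) x y : seq A := mkseq (shift x.+1 w) (y - x.+1).

Lemma seg_cat (A : Type) (w : nat -> A) x y z : x < y -> y < z ->
  seg w x z = seg w x y ++ w y :: seg w y z.
Proof.
move=> xy yz; rewrite /seg; have -> : z - x.+1 = y - x.+1 + (z - y.+1).+1 by lia.
by rewrite mkseqD mkseqS1 !shiftD addn1 subnKC // [shift y w 0]/shift addn0.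
Qed.

Lemma eq_seg (A : Type) (w v : nat -> A) x y : (forall n, n <= y -> w n = v n) ->
  seg w x y = seg v x y.
Proof.
move=> E; apply: (@eq_from_nth _ (w 0)); rewrite ?size_mkseq // => i lt_i.
by rewrite !nth_mkseq // /shift E //; lia.
Qed.

Section Game.
Variable A : finType.
Implicit Types (w : nat -> A) (zs : seq (nat * nat)).

(** A position of the Ehrenfeucht-Fraisse game on two infinite words, with [zs] pairing the marks.
    Nothing is said about letters before the first mark, so games are played with [(0, 0)] among the
    marks. *)
Record equ k w w' zs : Prop := Equ {
  equ_letter : forall z, z \in zs -> w z.1 = w' z.2;
  equ_suffix : forall z, z \in zs -> otp k (shift z.1.+1 w) = otp k (shift z.2.+1 w');
  equ_lt : forall y z, y \in zs -> z \in zs -> (y.1 < z.1) = (y.2 < z.2);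
  equ_seg : forall y z, y \in zs -> z \in zs -> y.1 < z.1 ->
    tp k (seg w y.1 z.1) = tp k (seg w' y.2 z.2)
}.

Lemma equ_sub k w w' zs zs' : {subset zs' <= zs} -> equ k w w' zs -> equ k w w' zs'.
Proof.
move=> sub [El Es Eo Ef]; split=> [z /sub/El|z /sub/Es|y z /sub ys /sub zz|y z /sub ys /sub zz] //.
  exact: Eo.
exact: Ef.
Qed.

Lemma equ_sym k w w' zs : equ k w w' zs -> equ k w' w [seq (z.2, z.1) | z <- zs].
Proof.
case=> El Es Eo Ef; split.
- by move=> _ /mapP[z zs_z ->]; rewrite El.
- by move=> _ /mapP[z zs_z ->]; rewrite Es.
- by move=> _ _ /mapP[y zs_y ->] /mapP[z zs_z ->]; rewrite /= Eo.
- by move=> _ _ /mapP[y zs_y ->] /mapP[z zs_z ->] /=; rewrite /= -Eo // => /Ef ->.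
Qed.

Lemma equ_pred k w w' zs : equ k.+1 w w' zs -> equ k w w' zs.
Proof.
case=> El Es Eo Ef; split=> // [z zs_z|y z zs_y zs_z lt_yz].
  by apply: otp_pred; apply: Es.
by apply: tp_pred; apply: Ef.
Qed.

Lemma equ_leq k k' w w' zs : k <= k' -> equ k' w w' zs -> equ k w w' zs.
Proof.
by move/subnK <-; elim: (k' - k) => // n IH; rewrite addSn => /equ_pred.
Qed.

Lemma equ_le k w w' zs y z : equ k w w' zs -> y \in zs -> z \in zs ->
  (y.1 <= z.1) = (y.2 <= z.2).
Proof. by move=> E ys zz; rewrite [LHS]leqNgt [RHS]leqNgt (equ_lt E). Qed.

Lemma equ_eq k w w' zs y z : equ k w w' zs -> y \in zs -> z \in zs ->
  (y.1 == z.1) = (y.2 == z.2).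
Proof. by move=> E ys zz; rewrite !eqn_leq !(equ_le E). Qed.

Lemma tp_seg_cat k w w' x y z x' y' z' : x < y -> y < z -> x' < y' -> y' < z' ->
  w y = w' y' -> tp k (seg w x y) = tp k (seg w' x' y') ->
  tp k (seg w y z) = tp k (seg w' y' z') -> tp k (seg w x z) = tp k (seg w' x' z').
Proof.
move=> xy yz xy' yz' wy E1 E2; rewrite (seg_cat w xy yz) (seg_cat w' xy' yz') wy.
by apply: tp_cat E1 _; apply: (@tp_cat _ k [:: _] [:: _]).
Qed.

Lemma otp_seg_cat k w w' x y x' y' : x < y -> x' < y' -> w y = w' y' ->
  tp k (seg w x y) = tp k (seg w' x' y') ->
  otp k (shift y.+1 w) = otp k (shift y'.+1 w') ->
  otp k (shift x.+1 w) = otp k (shift x'.+1 w').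
Proof.
move=> xy xy' wy Ef Es; have E u a b : a < b ->
    mkseq (shift a.+1 u) (b - a.+1).+1 = seg u a b ++ [:: u b] :> seq A.
  by move=> ab; rewrite -[(b - _).+1]addn1 mkseqD /seg shiftD subnKC // /mkseq /= /shift addn0.
apply: (otp_cat (n := (y - x.+1).+1) (n' := (y' - x'.+1).+1)).
  by rewrite !E //; apply: tp_cat => //; rewrite wy.
by rewrite !shiftD !addnS !subnKC.
Qed.

(* The duplicator's reply is chosen in the gap between the marks closest to [n];
   the mark [(0, 0)] ensures that there is one on the left. *)
Lemma equ_extend k w w' zs n : (0, 0) \in zs -> equ k.+1 w w' zs ->
  exists n', equ k w w' ((n, n') :: zs).
Proof.
move=> zs0 E1; have E := equ_pred E1.
have [/hasP[z zs_z /eqP <-]|/hasPn nozs] := boolP (has (fun z => z.1 == n) zs).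
  exists z.2; apply: equ_sub E => y; rewrite inE => /predU1P[->|//].
  by case: z zs_z.
pose left i := has (fun z => z.1 == i) zs && (i < n).
have exl : exists i, left i.
  exists 0; rewrite /left; have := nozs _ zs0; rewrite /= eq_sym lt0n => ->.
  by rewrite andbT; apply/hasP; exists (0, 0).
have lbnd i : left i -> i <= n by case/andP => _ /ltnW.
case: (ex_maxnP exl lbnd) => _ /andP[/hasP[x zs_x /eqP <-] lt_xn] xmax.
have {}xmax z : z \in zs -> z.1 < n -> z.1 <= x.1.
  by move=> zs_z lt_z; apply: xmax; rewrite /left lt_z andbT; apply/hasP; exists z.
have ne z : z \in zs -> z.1 < n \/ n < z.1.
  by move=> /nozs; rewrite neq_ltn => /orP.
(* Segments from marks to the left of [x] factor through [x], so a reply that is good relative to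
   [x] is good relative to all of them. *)
have leftP n' : x.2 < n' -> tp k (seg w x.1 n) = tp k (seg w' x.2 n') ->
    forall z, z \in zs -> z.1 < n ->
      z.2 < n' /\ tp k (seg w z.1 n) = tp k (seg w' z.2 n').
  move=> lt_xn' Ef z zs_z /(xmax _ zs_z); rewrite leq_eqVlt => /predU1P[e|lt].
    have /eqP e2 : z.2 == x.2 by rewrite -(equ_eq E) // e.
    by rewrite e e2.
  have lt2 : z.2 < x.2 by rewrite -(equ_lt E).
  split; first exact: ltn_trans lt_xn'.
  by apply: (tp_seg_cat lt lt_xn lt2 lt_xn' (equ_letter E zs_x)) => //; apply: (equ_seg E).
have build n' : w n = w' n' -> otp k (shift n.+1 w) = otp k (shift n'.+1 w') ->
    x.2 < n' -> tp k (seg w x.1 n) = tp k (seg w' x.2 n') ->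
    (forall z, z \in zs -> n < z.1 ->
      n' < z.2 /\ tp k (seg w n z.1) = tp k (seg w' n' z.2)) ->
    equ k w w' ((n, n') :: zs).
  move=> wn En lt_x' /(leftP _ lt_x') L R; split.
  - by move=> z; rewrite inE => /predU1P[->|/(equ_letter E)].
  - by move=> z; rewrite inE => /predU1P[->|/(equ_suffix E)].
  - move=> y z; rewrite !inE => /predU1P[->|zs_y] /predU1P[->|zs_z] /=.
    + by rewrite !ltnn.
    + case: (ne z zs_z) => lt; last by have [lt' _] := R _ zs_z lt; rewrite lt lt'.
      by have [lt' _] := L _ zs_z lt; rewrite !ltnNge (ltnW lt) (ltnW lt').
    + case: (ne y zs_y) => lt; first by have [lt' _] := L _ zs_y lt; rewrite lt lt'.
      by have [lt' _] := R _ zs_y lt; rewrite !ltnNge (ltnW lt) (ltnW lt').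
    + exact: (equ_lt E).
  move=> y z; rewrite !inE => /predU1P[->|zs_y] /predU1P[->|zs_z] /= lt.
  - by rewrite ltnn in lt.
  - by have [] := R _ zs_z lt.
  - by have [] := L _ zs_y lt.
  - exact: (equ_seg E).
have xn : x.1.+1 + (n - x.1.+1) = n by rewrite subnKC.
have [/hasP[y0 zs_y0 lt_y0]|/hasPn nor] := boolP (has (fun z => n < z.1) zs); last first.
  (* Without a mark to the right, the reply is a cut of the infinite suffix after [x.2]. *)
  have [j [F1 F2 F3]] := otp_cut (n - x.1.+1) (equ_suffix E1 zs_x).
  exists (x.2.+1 + j); apply: build.
  - by rewrite -{1}xn.
  - by move: F3; rewrite !shiftD !addnS xn.
  - by rewrite ltn_addr.
  - by rewrite /seg addKn.
  - by move=> z /nor; case: ltnP.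
pose right i := has (fun z => z.1 == i) zs && (n < i).
have exr : exists i, right i.
  by exists y0.1; rewrite /right lt_y0 andbT; apply/hasP; exists y0.
case: (ex_minnP exr) => _ /andP[/hasP[y zs_y /eqP <-] lt_ny] ymin.
have {}ymin z : z \in zs -> n < z.1 -> y.1 <= z.1.
  by move=> zs_z lt_z; apply: ymin; rewrite /right lt_z andbT; apply/hasP; exists z.
have lt_xy := ltn_trans lt_xn lt_ny.
have lt_xy' : x.2 < y.2 by rewrite -(equ_lt E).
(* Between the neighbouring marks [x] and [y] the reply is a cut of the segment in [w']; the length
   of its left part locates [n']. *)
have [s1 [s2 [sE F1 F2]]] := tp_cut (equ_seg E1 zs_x zs_y lt_xy) (seg_cat w lt_xn lt_ny).
pose n' := x.2.+1 + size s1.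
have lt_n'y : n' < y.2.
  have := congr1 size sE; rewrite size_mkseq size_cat /= => sz.
  by rewrite -ltn_subRL sz addnS ltnS leq_addr.
have lt_xn' : x.2 < n' by rewrite ltn_addr.
have [s1E [wE s2E]] : seg w' x.2 n' = s1 /\ w' n' = w n /\ seg w' n' y.2 = s2.
  move: sE; rewrite (@seg_cat _ w' x.2 n') // => /eqP.
  rewrite eqseq_cat ?eqseq_cons; last by rewrite size_mkseq addKn.
  by case/and3P => /eqP-> /eqP-> /eqP->.
exists n'; apply: build; rewrite ?s1E //.
  apply: otp_seg_cat lt_ny lt_n'y (equ_letter E zs_y) _ (equ_suffix E zs_y).
  by rewrite s2E.
move=> z zs_z lt_nz; have := ymin z zs_z lt_nz; rewrite leq_eqVlt => /predU1P[e|lt].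
  have /eqP e2 : z.2 == y.2 by rewrite -(equ_eq E) // e.
  by rewrite -e e2 s2E.
have lt2 : y.2 < z.2 by rewrite -(equ_lt E).
split; first exact: ltn_trans lt2.
apply: (tp_seg_cat lt_ny lt lt_n'y lt2 (equ_letter E zs_y)); rewrite ?s2E //.
exact: (equ_seg E).
Qed.

(** Adjacent positions enclose an empty open segment, which rank 1 recognises. *)
Lemma equ_succ k w w' zs x x' y y' : equ k.+1 w w' zs ->
  (x, x') \in zs -> (y, y') \in zs -> y = x.+1 -> y' = x'.+1.
Proof.
move=> E xs ys yE; have lt : x < y by lia.
have lt' : x' < y' by rewrite -[x']/(x, x').2 -[y']/(y, y').2 -(equ_lt E).
have := equ_seg E xs ys lt; rewrite {1}/seg /= yE subnn => /esym/tp_nil/(congr1 size).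
rewrite size_mkseq /=; lia.
Qed.

End Game.

Lemma equ_map (A A' : finType) (f : A -> A') k w w' zs :
  equ k w w' zs -> equ k (f \o w) (f \o w') zs.
Proof.
case=> El Es Eo Ef; split=> //.
- by move=> z /El /= ->.
- by move=> z /Es /(otp_map f).
move=> y z ys zz lt; have comp v x n : seg (f \o v) x n = map f (seg v x n).
  by rewrite /seg /mkseq -map_comp.
by rewrite !comp; apply: tp_map; apply: Ef.
Qed.

(** * From hybrid formulas to CTL* and back *)

Section Branching.
Variable AP : finType.

Lemma is_path_shift (K : Kripke AP) (p : nat -> St K) n : is_path p -> is_path (shift n p).
Proof. by move=> Hp m; rewrite /shift addnS; apply: Hp. Qed.

Lemma csat_shift (K : Kripke AP) (p : nat -> St K) i c :
  csat p i c <-> csat (shift i p) 0 c.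
Proof.
elim: c p i => //= [a|c IH|c IHc d IHd|c IH|c IHc d IHd|c IH] p i.
- by rewrite /shift addn0.
- by rewrite IH.
- by rewrite IHc IHd.
- by rewrite IH (IH _ 1) shiftD addn1.
- have Ec k : i <= k -> csat p k c <-> csat (shift i p) (k - i) c.
    by move=> le; rewrite IHc (IHc (shift i p)) shiftD subnKC.
  have Ed k : i <= k -> csat p k d <-> csat (shift i p) (k - i) d.
    by move=> le; rewrite IHd (IHd (shift i p)) shiftD subnKC.
  split=> -[j [le_j [dj cj]]].
    exists (j - i); split=> //; split; first exact/Ed.
    move=> k _ lt_k; have := Ec (i + k) (leq_addr _ _); rewrite addKn => <-.
    by apply: cj; lia.
  exists (i + j); split; first exact: leq_addr.
  split; first by apply/Ed; rewrite ?leq_addr // addKn.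
  by move=> k le_k lt_k; apply/Ec => //; apply: cj => //; lia.
- by rewrite /shift addn0.
Qed.

(** * Path properties definable in CTL* uniformly in the Kripke structure *)

Definition cdef (P : forall K : Kripke AP, (nat -> St K) -> Prop) :=
  exists c, forall (K : Kripke AP) (p : nat -> St K), is_path p -> csat p 0 c <-> P K p.

Implicit Types P Q : forall K : Kripke AP, (nat -> St K) -> Prop.

Lemma cdef_ext P Q : (forall K p, is_path p -> P K p <-> Q K p) -> cdef P -> cdef Q.
Proof. by move=> E [c cP]; exists c => K p Hp; rewrite cP // E. Qed.

Lemma cdef_const (b : Prop) : cdef (fun _ _ => b).
Proof.
by have [hb|nb] := pselect b; [exists (CTop AP) | exists (CNot (CTop AP))] => K p _ /=; tauto.
Qed.

Lemma cdef_not P : cdef P -> cdef (fun K p => ~ P K p).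
Proof. by case=> c cP; exists (CNot c) => K p Hp /=; rewrite cP. Qed.

Lemma cdef_and P Q : cdef P -> cdef Q -> cdef (fun K p => P K p /\ Q K p).
Proof. by move=> [c cP] [d dQ]; exists (CAnd c d) => K p Hp /=; rewrite cP // dQ. Qed.

Lemma cdef_iff P Q : cdef P -> cdef Q -> cdef (fun K p => P K p <-> Q K p).
Proof.
move=> hP hQ; apply: cdef_ext (cdef_and (cdef_not (cdef_and hP (cdef_not hQ)))
  (cdef_not (cdef_and hQ (cdef_not hP)))) => K p _.
by have [] := pselect (P K p); have [] := pselect (Q K p); tauto.
Qed.

Lemma cdef_forall (I : finType) (P : I -> forall K : Kripke AP, (nat -> St K) -> Prop) :
  (forall i, cdef (P i)) -> cdef (fun K p => forall i, P i K p).
Proof.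
move=> h; suff hs (s : seq I) : cdef (fun K p => forall i, i \in s -> P i K p).
  by apply: cdef_ext (hs (enum I)) => K p _; split=> H i *; apply: H; rewrite ?mem_enum.
elim: s => [|i s IH]; first by apply: cdef_ext (cdef_const True).
apply: cdef_ext (cdef_and (h i) IH) => K p _; split.
  by case=> Pi Ps k; rewrite inE => /predU1P[->|/Ps].
by move=> H; split=> [|k ks]; apply: H; rewrite inE ?eqxx ?ks ?orbT.
Qed.

Lemma cdef_next P : cdef P -> cdef (fun K p => P K (shift 1 p)).
Proof.
case=> c cP; exists (CNext c) => K p Hp; rewrite -cP; last exact: is_path_shift.
exact: (csat_shift p 1 c).
Qed.

Lemma cdef_until P Q : cdef P -> cdef Q ->
  cdef (fun K p => exists j, Q K (shift j p) /\ forall i, i < j -> P K (shift i p)).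
Proof.
move=> [c cP] [d dQ]; exists (CUntil c d) => K p Hp /=.
have Hs i := is_path_shift i Hp.
split=> [[j [_ [dj cj]]]|[j [dj cj]]]; exists j.
  split; first by rewrite -dQ // -csat_shift.
  by move=> i lt_i; rewrite -cP // -csat_shift; apply: cj.
split=> //; split; first by rewrite csat_shift dQ.
by move=> i _ lt_i; rewrite csat_shift cP //; apply: cj.
Qed.

Lemma cdef_ex P : cdef P ->
  cdef (fun K p => exists q, [/\ is_path q, q 0 = p 0 & P K q]).
Proof.
case=> c cP; exists (CEx c) => K p Hp /=.
split=> [[q [Hq [q0 cq]]]|[q [Hq q0 cq]]]; exists q; split=> //; first exact/cP.
by split=> //; apply/cP.
Qed.

(* A finite labelling of states whose classes are CTL*-definable, uniformly in
   the Kripke structure. *)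
Record labelling := Labelling {
  alph : finType;
  lab : forall K : Kripke AP, St K -> alph;
  lab_cdef : forall a, cdef (fun K p => lab (p 0) = a)
}.

Definition word (L : labelling) (K : Kripke AP) (p : nat -> St K) : nat -> alph L :=
  fun n => lab L (p n).

(** Letters are replaced by the CTL* formulas defining their labels; the LTL operators are path
    operators of CTL*. *)
Lemma cdef_ltl (L : labelling) D : ltl D -> cdef (fun K p => D (word L p)).
Proof.
elim=> {D} [|a|D _ IH|D1 D2 _ IH1 _ IH2|D _ IH|D1 D2 _ IH1 _ IH2].
- exact: cdef_const.
- exact: lab_cdef.
- exact: cdef_not.
- exact: cdef_and.
- exact: (cdef_next IH).
- exact: (cdef_until IH1 IH2).
Qed.

Definition label_pred (P : forall K : Kripke AP, St K -> bool)
  (h : cdef (fun K p => P K (p 0))) : labelling.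
Proof.
refine (@Labelling bool P _) => b.
apply: cdef_ext (cdef_iff h (cdef_const b)) => K p _; split=> [E|-> //].
by apply/idP/idP => /E.
Defined.

Definition label_pair (L1 L2 : labelling) : labelling.
Proof.
refine (@Labelling (alph L1 * alph L2)%type (fun K s => (lab L1 s, lab L2 s)) _) => -[a b].
apply: cdef_ext (cdef_and (lab_cdef (l := L1) a) (lab_cdef (l := L2) b)) => K p _.
by split=> [[-> ->]|[]].
Defined.

(** The current letter is left out by [shift 1], to match [equ_suffix], which speaks of what follows
    a mark. *)
Definition future_types (L : labelling) (k : nat) (K : Kripke AP) (s : St K) :
    {set ty (alph L) k} :=
  [set t | `[< exists q, [/\ is_path q, q 0 = s & otp k (shift 1 (word L q)) = t] >]].

(** Membership of a single type [t] is an existential path quantifier over an LTL property, by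
    [ltl_otp]; as there are finitely many [t], the whole set is definable. *)
Definition label_future (L : labelling) (k : nat) : labelling.
Proof.
refine (@Labelling (alph L * {set ty (alph L) k})%type
          (fun K s => (lab L s, future_types L k s)) _) => -[a T].
apply: cdef_ext (cdef_and (lab_cdef (l := L) a) (cdef_forall (fun t =>
  cdef_iff (cdef_ex (cdef_ltl (ltl_next (ltl_otp t)))) (cdef_const (t \in T))))) => K p _.
split=> [[-> H]|[-> <-]]; last by split=> // t; rewrite inE; split=> /asboolP.
by congr (_, _); apply/setP => t; rewrite inE; apply/asboolP/idP => /H.
Defined.

(** The paths may lie in different Kripke structures, so truth depends on the marked word of labels
    alone. One implication suffices, as [equ_sym] exchanges the sides. *)
Definition invariant (L : labelling) (k : nat) (f : hform AP) : Prop :=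
  forall (K K' : Kripke AP) (p : nat -> St K) (p' : nat -> St K') g g' i i' zs,
    is_init_path p -> is_init_path p' -> (0, 0) \in zs -> (i, i') \in zs ->
    (forall x, x \in fv f -> (g x, g' x) \in zs) ->
    equ k (word L p) (word L p') zs -> hsat p g i f -> hsat p' g' i' f.

Definition refines (L' L : labelling) :=
  exists pi : alph L' -> alph L, forall K (s : St K), lab L s = pi (lab L' s).

Lemma equ_refines (L' L : labelling) k (K K' : Kripke AP) (p : nat -> St K)
    (p' : nat -> St K') zs : refines L' L ->
  equ k (word L' p) (word L' p') zs -> equ k (word L p) (word L p') zs.
Proof.
case=> pi piE /(equ_map pi).
by congr equ; apply: funext => n; rewrite /word piE.
Qed.

Lemma invariant_mono (L L' : labelling) k k' f : refines L' L -> k <= k' ->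
  invariant L k f -> invariant L' k' f.
Proof.
move=> rL le_k inv K K' p p' g g' i i' zs Hp Hp' z0 zi zf E.
by apply: (inv _ _ _ _ _ _ _ _ zs) => //; apply: equ_refines rL (equ_leq le_k E).
Qed.

Lemma invariant2 L1 L2 k1 k2 f1 f2 : invariant L1 k1 f1 -> invariant L2 k2 f2 ->
  exists L k, invariant L k f1 /\ invariant L k f2.
Proof.
move=> i1 i2; exists (label_pair L1 L2), (maxn k1 k2); split.
  by apply: invariant_mono i1; [exists fst | apply: leq_maxl].
by apply: invariant_mono i2; [exists snd | apply: leq_maxr].
Qed.

Lemma invariant_iff L k f (K K' : Kripke AP) (p : nat -> St K) (p' : nat -> St K')
    g g' i i' zs : invariant L k f ->
    is_init_path p -> is_init_path p' -> (0, 0) \in zs -> (i, i') \in zs ->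
    (forall x, x \in fv f -> (g x, g' x) \in zs) ->
    equ k (word L p) (word L p') zs -> hsat p g i f <-> hsat p' g' i' f.
Proof.
move=> inv Hp Hp' z0 zi zf E; split.
  exact: (inv _ _ _ _ _ _ _ _ _ Hp Hp' z0 zi zf E).
apply: (inv _ _ _ _ _ _ _ _ _ Hp' Hp _ _ _ (equ_sym E)).
- by apply/mapP; exists (0, 0).
- by apply/mapP; exists (i, i').
- by move=> x /zf zx; apply/mapP; exists (g x, g' x).
Qed.

(** One rank pays for the mark on the next position, the other keeps adjacency visible to
    [equ_succ]. *)
Lemma inv_next L k f : invariant L k f -> invariant L k.+2 (HNext f).
Proof.
move=> inv K K' p p' g g' i i' zs Hp Hp' z0 zi zf E /=.
have [j' E'] := equ_extend i.+1 z0 E.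
have sub x : x \in zs -> x \in (i.+1, j') :: zs by move=> xz; rewrite inE xz orbT.
have jE : j' = i'.+1 by apply: (equ_succ E' (sub _ zi) (mem_head _ _)).
rewrite -jE; apply: (inv _ _ _ _ _ _ _ _ _ Hp Hp' (sub _ z0) (mem_head _ _) _ (equ_pred E')).
by move=> x /zf /sub.
Qed.

Lemma inv_prev L k f : invariant L k f -> invariant L k.+2 (HPrev f).
Proof.
move=> inv K K' p p' g g' i i' zs Hp Hp' z0 zi zf E /= [i_gt0].
have [j' E'] := equ_extend i.-1 z0 E.
have sub x : x \in zs -> x \in (i.-1, j') :: zs by move=> xz; rewrite inE xz orbT.
have -> : i' = j'.+1 by apply: (equ_succ E' (mem_head _ _) (sub _ zi)); lia.
move=> H; split=> //=; move: H.
apply: (inv _ _ _ _ _ _ _ _ _ Hp Hp' (sub _ z0) (mem_head _ _) _ (equ_pred E')).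
by move=> x /zf /sub.
Qed.

(** The first round transfers the witness [j], the second answers a position [m'] between [i'] and
    [j']. *)
Lemma inv_until L k f1 f2 : invariant L k f1 -> invariant L k f2 ->
  invariant L k.+2 (HUntil f1 f2).
Proof.
move=> inv1 inv2 K K' p p' g g' i i' zs Hp Hp' z0 zi zf E /= [j [le_ij [fj fk]]].
have [j' E1] := equ_extend j z0 E.
have sub1 x : x \in zs -> x \in (j, j') :: zs by move=> xz; rewrite inE xz orbT.
have z1 := mem_head (j, j') zs.
exists j'; split; first by have /= <- := equ_le E1 (sub1 _ zi) z1.
split.
  apply: (inv2 _ _ _ _ _ _ _ _ _ Hp Hp' (sub1 _ z0) z1 _ (equ_pred E1) fj).
  by move=> x xf; apply/sub1/zf; rewrite mem_cat xf orbT.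
move=> m' le_m lt_m.
(* This challenge comes from the other word, so the game is turned round by [equ_sym] and back. *)
have [|m /equ_sym] := equ_extend m' _ (equ_sym E1).
  by apply/mapP; exists (0, 0); rewrite ?sub1.
rewrite map_cons -map_comp map_id_in; last by case.
set zs2 := (_, _) :: _ => E2.
have sub2 x : x \in (j, j') :: zs -> x \in zs2 by move=> xz; rewrite inE xz orbT.
have zm : (m, m') \in zs2 by apply: mem_head.
apply: (inv1 _ _ _ _ _ _ _ _ _ Hp Hp' (sub2 _ (sub1 _ z0)) zm _ E2).
  by move=> x xf; apply/sub2/sub1/zf; rewrite mem_cat xf.
apply: fk; first by have /= -> := equ_le E2 (sub2 _ (sub1 _ zi)) zm.
by have /= -> := equ_lt E2 zm (sub2 _ z1).
Qed.

Lemma inv_since L k f1 f2 : invariant L k f1 -> invariant L k f2 ->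
  invariant L k.+2 (HSince f1 f2).
Proof.
move=> inv1 inv2 K K' p p' g g' i i' zs Hp Hp' z0 zi zf E /= [j [le_ij [fj fk]]].
have [j' E1] := equ_extend j z0 E.
have sub1 x : x \in zs -> x \in (j, j') :: zs by move=> xz; rewrite inE xz orbT.
have z1 := mem_head (j, j') zs.
exists j'; split; first by have /= <- := equ_le E1 z1 (sub1 _ zi).
split.
  apply: (inv2 _ _ _ _ _ _ _ _ _ Hp Hp' (sub1 _ z0) z1 _ (equ_pred E1) fj).
  by move=> x xf; apply/sub1/zf; rewrite mem_cat xf orbT.
move=> m' lt_m le_m.
have [|m /equ_sym] := equ_extend m' _ (equ_sym E1).
  by apply/mapP; exists (0, 0); rewrite ?sub1.
rewrite map_cons -map_comp map_id_in; last by case.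
set zs2 := (_, _) :: _ => E2.
have sub2 x : x \in (j, j') :: zs -> x \in zs2 by move=> xz; rewrite inE xz orbT.
have zm : (m, m') \in zs2 by apply: mem_head.
apply: (inv1 _ _ _ _ _ _ _ _ _ Hp Hp' (sub2 _ (sub1 _ z0)) zm _ E2).
  by move=> x xf; apply/sub2/sub1/zf; rewrite mem_cat xf.
apply: fk; first by have /= -> := equ_lt E2 (sub2 _ z1) zm.
by have /= -> := equ_le E2 zm (sub2 _ (sub1 _ zi)).
Qed.

Definition splice (T : Type) (p r : nat -> T) i : nat -> T :=
  fun n => if n <= i then p n else r (n - i).

Lemma splice_path (K : Kripke AP) (p r : nat -> St K) i :
  is_init_path p -> is_path r -> r 0 = p i -> is_init_path (splice p r i).
Proof.
move=> [Hp p0] Hr r0; split=> // n; rewrite /splice.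
have [lt_ni|lt_in|->] := ltngtP n i; last by rewrite subSnn -r0.
  by rewrite Hp.
have -> : n.+1 - i = (n - i).+1 by lia.
exact: Hr.
Qed.

Lemma shift_splice (T : Type) (p r : nat -> T) i :
  shift i.+1 (splice p r i) = shift 1 r.
Proof.
apply: funext => n; rewrite /shift /splice addSn ltnNge leq_addr /=.
by congr r; lia.
Qed.

(* The witnessing path is transferred by keeping the history of [p'] and
   following a future of the same type, which [label_future] makes available. *)
Lemma inv_ex L k f (K K' : Kripke AP) (p : nat -> St K) (p' : nat -> St K') g g' i i' zs :
  invariant L k f -> is_init_path p -> is_init_path p' -> (0, 0) \in zs -> (i, i') \in zs ->
  (forall x, x \in fv f -> (g x, g' x) \in zs /\ g x <= i) ->
  equ k (word (label_future L k) p) (word (label_future L k) p') zs ->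
  hsat p g i (HEx f) -> hsat p' g' i' (HEx f).
Proof.
move=> inv Hp Hp' z0 zi zf E /= [q [Hq [qp sq]]].
have EL : equ k (word L p) (word L p') zs by apply: equ_refines E; exists fst.
(* The labels at [i] and [i'] agree, hence so do their sets of future types; [r] realises the type
   of the future of [q]. *)
have [r [Hr r0 rt]] : exists r, [/\ is_path r, r 0 = p' i' &
    otp k (shift 1 (word L r)) = otp k (shift i.+1 (word L q))].
  have [_] := equ_letter E zi; rewrite /= => /setP/(_ (otp k (shift i.+1 (word L q)))).
  rewrite !inE; case: asboolP => [_ /esym/asboolP //|[]].
  exists (shift i q); split; first by apply: is_path_shift; case: Hq.
    by rewrite /shift addn0 qp.
  by rewrite -[word L (shift i q)]/(shift i (word L q)) shiftD addn1.
pose q' := splice p' r i'.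
have q'p n : n <= i' -> q' n = p' n by rewrite /q' /splice => ->.
have Hq' : is_init_path q' by apply: splice_path.
exists q'; split=> //; split=> //.
(* Marks after [i] are dropped, since [q] is known to follow [p] only up to [i]. *)
pose zs' := [seq z <- zs | z.1 <= i].
have mem' z : z \in zs' -> [/\ z \in zs, z.1 <= i & z.2 <= i'].
  by rewrite mem_filter => /andP[le zz]; split=> //; have /= <- := equ_le EL zz zi.
have segE y z : y \in zs' -> z \in zs' -> y.1 < z.1 ->
    tp k (seg (word L q) y.1 z.1) = tp k (seg (word L q') y.2 z.2).
  move=> /mem'[yz _ _] /mem'[zz le le'] lt.
  have -> : seg (word L q) y.1 z.1 = seg (word L p) y.1 z.1.
    by apply: eq_seg => n le_n; rewrite /word qp // (leq_trans le_n).
  have -> : seg (word L q') y.2 z.2 = seg (word L p') y.2 z.2.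
    by apply: eq_seg => n le_n; rewrite /word q'p // (leq_trans le_n).
  exact: (equ_seg EL).
have letE z : z \in zs' -> word L q z.1 = word L q' z.2.
  by move=> /mem'[zz le le']; rewrite /word qp // q'p //; apply: (equ_letter EL).
have zi' : (i, i') \in zs' by rewrite mem_filter leqnn.
have sufE : otp k (shift i.+1 (word L q)) = otp k (shift i'.+1 (word L q')).
  by rewrite -rt -[shift i'.+1 _]/(word L (shift i'.+1 q')) shift_splice.
apply: (inv _ _ _ _ _ _ _ _ zs' Hq Hq' _ zi' _ _ sq); first by rewrite mem_filter.
  by move=> x /zf[zx le]; rewrite mem_filter le.
split=> //.
- move=> z zz'; have [zz le _] := mem' _ zz'.
  move: le; rewrite leq_eqVlt => /predU1P[e|lt].
    have /eqP e2 : z.2 == i' by rewrite -(equ_eq EL zz zi) /= e.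
    by rewrite e e2.
  have lt' : z.2 < i' by have /= <- := equ_lt EL zz zi.
  exact: otp_seg_cat lt lt' (letE _ zi') (segE _ _ zz' zi' lt) sufE.
- by move=> y z /mem'[yz _ _] /mem'[zz _ _]; apply: (equ_lt EL).
Qed.

(** The guard places the mark in the history, which is the condition [inv_ex] asks of free
    variables. *)
Lemma hsat_ctx (K : Kripke AP) (p : nat -> St K) g i x f :
  hsat p g i (HAnd (HOnce (HVar AP x)) (HEx f)) <-> g x <= i /\ hsat p g i (HEx f).
Proof.
have -> : g x <= i <-> hsat p g i (HOnce (HVar AP x)).
  by split=> [le|[j [le [-> _]]]] //; exists (g x).
rewrite /HAnd; move: (HOnce _) (HEx f) => a b /=.
by have [] := pselect (hsat p g i a); have [] := pselect (hsat p g i b); tauto.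
Qed.

Definition invariable f := exists L k, invariant L k f.

Lemma wf_not (h : hform AP) : wf (HNot h) -> wf h \/ exists x psi,
  [/\ HNot h = HAnd (HOnce (HVar AP x)) (HEx psi),
      {in fv psi, forall y, y = x} & wf psi].
Proof.
case: h => [|a|x|h|h1 h2|x h|h|h1 h2|h|h1 h2|h] //; try by left.
case: h1 => [|a|x|h1|h11 h12|x h|h|h11 h12|h|h11 h12|h]; try by left.
case: h1 => [|a|x|h1|h11 h12|x h|h|h11 h12|h|h11 h12|h]; try by left.
case: h11 => [|a|x|h1|h11 h13|x h|h|h11 h13|h|h11 h13|h]; try by left.
case: h12 => [|a|x|h1|h11 h13|x h|h|h11 h13|h|h11 h13|h]; try by left.
case: h2 => [|a|y|h1|h11 h13|y h|h|h11 h13|h|h11 h13|h]; try by left.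
case: h1 => [|a|y|h1|h11 h13|y h|h|h11 h13|h|h11 h13|h]; try by left.
case/orP=> [/andP[/allP fx wh]|]; last by left.
by right; exists x, h; split=> // y /fx /eqP.
Qed.

Fixpoint hsize (f : hform AP) : nat :=
  match f with
  | HTop | HAtom _ | HVar _ => 1
  | HNot h | HNext h | HPrev h | HEx h | HBind _ h => (hsize h).+1
  | HOr h1 h2 | HUntil h1 h2 | HSince h1 h2 => (hsize h1 + hsize h2).+1
  end.

Definition label_top : labelling := label_pred (P := fun _ _ => true) (cdef_const true).

Lemma wf_invariable (f : hform AP) : wf f -> invariable f.
Proof.
(* Induction on size, because in the guarded context [psi] lies several constructors below the
   formula. *)
have [n] := ubnP (hsize f); elim: n f => // n IH.
have IH1 h : (hsize h).+1 < n.+1 -> wf h -> invariable h by move=> lt; apply: IH.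
have IH2 h1 h2 : (hsize h1 + hsize h2).+1 < n.+1 -> wf h1 && wf h2 ->
    exists L k, invariant L k h1 /\ invariant L k h2.
  move=> lt /andP[w1 w2]; have [|L1 [k1 i1]] := IH h1 _ w1; first by lia.
  by have [|L2 [k2 i2]] := IH h2 _ w2; [lia | apply: invariant2 i1 i2].
case=> [|a|x|h|h1 h2|x h|h|h1 h2|h|h1 h2|h] size_f wf_f.
- by exists label_top, 0.
- have ha : cdef (fun K p => a \in mu (p 0)) by exists (CAtom a).
  exists (label_pred (P := fun K s => a \in mu s) ha), 0 => K K' p p' g g' i i' zs _ _ _ zi _ E /=.
  by have := equ_letter E zi; rewrite /word /= => ->.
- exists label_top, 0 => K K' p p' g g' i i' zs _ _ _ zi zf E /= /eqP gx.
  by apply/eqP; have /= <- := equ_eq E (zf x (mem_head _ _)) zi.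
- have [wf_h|[x [psi [hE fvx wf_psi]]]] := wf_not wf_f.
    have [L [k inv]] := IH1 h size_f wf_h.
    exists L, k => K K' p p' g g' i i' zs Hp Hp' z0 zi zf E /= nh H; apply: nh.
    by apply/(invariant_iff inv Hp Hp' z0 zi zf E).
  move: size_f; rewrite hE => size_f.
  have [|L [k inv]] := IH psi _ wf_psi; first by move: size_f => /=; lia.
  exists (label_future L k), k => K K' p p' g g' i i' zs Hp Hp' z0 zi zf E.
  rewrite !hsat_ctx => -[le H].
  have zx : (g x, g' x) \in zs by apply: zf; rewrite /= mem_head.
  split; first by have /= <- := equ_le E zx zi.
  by apply: inv_ex inv Hp Hp' z0 zi _ E H => y /fvx ->.
- have [L [k [inv1 inv2]]] := IH2 h1 h2 size_f wf_f.
  exists L, k => K K' p p' g g' i i' zs Hp Hp' z0 zi zf E /= [H|H]; [left|right]; move: H.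
    apply: (inv1 _ _ _ _ _ _ _ _ _ Hp Hp' z0 zi _ E).
    by move=> y yf; apply: zf; rewrite mem_cat yf.
  apply: (inv2 _ _ _ _ _ _ _ _ _ Hp Hp' z0 zi _ E).
  by move=> y yf; apply: zf; rewrite mem_cat yf orbT.
- have [L [k inv]] := IH1 h size_f wf_f.
  exists L, k => K K' p p' g g' i i' zs Hp Hp' z0 zi zf E /=.
  apply: (inv _ _ _ _ _ _ _ _ _ Hp Hp' z0 zi _ E) => y yf.
  by have [//|ne] := eqVneq y x; apply: zf; rewrite mem_filter ne.
- by have [L [k inv]] := IH1 h size_f wf_f; exists L, k.+2; apply: inv_next.
- have [L [k [inv1 inv2]]] := IH2 h1 h2 size_f wf_f.
  by exists L, k.+2; apply: inv_until.
- by have [L [k inv]] := IH1 h size_f wf_f; exists L, k.+2; apply: inv_prev.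
- have [L [k [inv1 inv2]]] := IH2 h1 h2 size_f wf_f.
  by exists L, k.+2; apply: inv_since.
move/andP: wf_f => [/nilP fv0 wf_h]; have [L [k inv]] := IH1 h size_f wf_h.
exists (label_future L k), k => K K' p p' g g' i i' zs Hp Hp' z0 zi zf E.
by apply: inv_ex inv Hp Hp' z0 zi _ E; rewrite fv0.
Qed.

(** For a sentence at position 0, [(0, 0)] is the only mark, so truth depends on the first letter
    and the type of the rest. The CTL* formula is the disjunction over the finitely many such pairs
    that occur, in any structure, on an initial path satisfying [f]. *)
Lemma ctl_of_hybrid (f : hform AP) : sentence f -> wf f -> exists c, equiv_hc f c.
Proof.
move=> /nilP fv0 /wf_invariable[L [k inv]].
pose real (a : alph L) (t : ty (alph L) k) := exists (K : Kripke AP) (p : nat -> St K),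
  [/\ is_init_path p, word L p 0 = a, otp k (shift 1 (word L p)) = t & hsat p (fun=> 0) 0 f].
have lD := ltl_exists (fun at_ : alph L * ty (alph L) k => ltl_and
  (ltl_const _ (real at_.1 at_.2))
  (ltl_and (ltl_letter at_.1) (ltl_next (ltl_otp at_.2)))).
have [c cP] := cdef_ltl lD.
suff E (K : Kripke AP) (p : nat -> St K) : is_init_path p ->
    csat p 0 c <-> hsat p (fun=> 0) 0 f.
  by exists c => K; split=> H p Hp; apply/E => //; apply: H.
move=> Hp; rewrite cP; last by case: Hp.
split=> [[[a t] /= [[K' [p' [Hp' w0 wt H]]] [w0' wt']]]|H]; last first.
  by exists (word L p 0, otp k (shift 1 (word L p))); split=> //; exists K, p.
apply: (inv _ _ _ _ _ _ _ _ [:: (0, 0)] Hp' Hp _ _ _ _ H); rewrite ?mem_head ?fv0 //.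
split=> [z|z|y z|y z]; rewrite !inE => /eqP->; rewrite ?w0 ?w0' ?wt ?wt' //.
  by move=> /eqP->.
by move=> /eqP->.
Qed.

(** * Embedding CTL* into the hybrid logic *)

Fixpoint hybrid_of_ctl (c : cform AP) : hform AP :=
  match c with
  | CTop => HTop AP
  | CAtom a => HAtom a
  | CNot c => HNot (hybrid_of_ctl c)
  | CAnd c d => HAnd (hybrid_of_ctl c) (hybrid_of_ctl d)
  | CNext c => HNext (hybrid_of_ctl c)
  | CUntil c d => HUntil (hybrid_of_ctl c) (hybrid_of_ctl d)
  | CEx c => HEx (hybrid_of_ctl c)
  end.

Lemma wf_hnot (h : hform AP) : wf h -> wf (HNot h).
Proof.
case: h => [|a|x|h|h1 h2|x h|h|h1 h2|h|h1 h2|h] //.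
case: h1 => [|a|x|h1|h11 h12|x h|h|h11 h12|h|h11 h12|h] //.
case: h1 => [|a|x|h1|h11 h12|x h|h|h11 h12|h|h11 h12|h] //.
case: h11 => [|a|x|h1|h11 h13|x h|h|h11 h13|h|h11 h13|h] //.
case: h12 => [|a|x|h1|h11 h13|x h|h|h11 h13|h|h11 h13|h] //.
case: h2 => [|a|y|h1|h11 h13|y h|h|h11 h13|h|h11 h13|h] //.
case: h1 => [|a|y|h1|h11 h13|y h|h|h11 h13|h|h11 h13|h] //.
by move=> H; apply/orP; right.
Qed.

Lemma fv_hybrid_of_ctl c : fv (hybrid_of_ctl c) = [::].
Proof. by elim: c => //= [c -> d ->|c -> d ->]. Qed.

Lemma wf_hybrid_of_ctl c : wf (hybrid_of_ctl c).
Proof.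
elim: c => // [c IH|c IHc d IHd|c IHc d IHd|c IH].
- exact: wf_hnot.
- by apply: wf_hnot; apply/andP; split; apply: wf_hnot.
- by apply/andP.
- by apply/andP; rewrite fv_hybrid_of_ctl.
Qed.

(** [HEx] keeps the history while [CEx] starts a fresh path; [shift] and [splice] convert the
    witnesses, since CTL* truth depends only on the suffix. *)
Lemma hsat_hybrid_of_ctl c (K : Kripke AP) (p : nat -> St K) g i : is_init_path p ->
  hsat p g i (hybrid_of_ctl c) <-> csat p i c.
Proof.
elim: c p i => //= [c IH|c IHc d IHd|c IH|c IHc d IHd|c IH] p i Hp.
- by rewrite IH.
- rewrite IHc // IHd //.
  by have [] := pselect (csat p i c); have [] := pselect (csat p i d); tauto.
- by rewrite IH.
- split=> -[j [le_j [dj cj]]]; exists j; split=> //; split; try exact/IHd;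
    by move=> k k1 k2; apply/IHc/cj.
- split=> [[q [Hq [qp Hs]]]|[r [Hr [r0 Hs]]]].
    exists (shift i q); split; first by apply: is_path_shift; case: Hq.
    by split; [rewrite /shift addn0 qp | rewrite -csat_shift -(IH _ _ Hq)].
  have Hq := splice_path Hp Hr r0.
  exists (splice p r i); split=> //; split; first by move=> k; rewrite /splice => ->.
  rewrite IH // csat_shift; suff -> : shift i (splice p r i) = r by [].
  apply: funext => n; rewrite /shift /splice; case: n => [|n]; first by rewrite addn0 leqnn.
  by rewrite addnS ltnNge leq_addr /=; congr r; lia.
Qed.

End Branching.

Theorem theorem4p14 (AP : finType) :
  (forall f : hform AP, sentence f -> wf f -> exists c : cform AP, equiv_hc f c) /\
  (forall c : cform AP, exists f : hform AP, [/\ sentence f, wf f & equiv_hc f c]).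
Proof.
split; first exact: ctl_of_hybrid.
move=> c; exists (hybrid_of_ctl c); split.
- by rewrite /sentence fv_hybrid_of_ctl.
- exact: wf_hybrid_of_ctl.
by move=> K; split=> H p Hp; apply/hsat_hybrid_of_ctl => //; apply: H.
Qed.
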